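(* Let $R$ and $S$ be $F$-finite noetherian $\mathbb{F}_p$-algebras satisfying $\mathbf{G}_1+\mathbf{S}_2$, and let $f\colon\operatorname{Spec}S\to\operatorname{Spec}R$ be a finite dominant morphism. Suppose that $R$ is either local or of finite type over a field. Choose $T\in\omega_{S/R}=\operatorname{Hom}_R(S,R)$ such that the $S$-linear map $S\to\omega_{S/R}$, $1\mapsto T$, is generically an isomorphism. Let $K$ be the total ring of fractions of $R$, $L=K\otimes_RS$, and $T_K=K\otimes_RT\colon L\to K$. Let $\mathcal{C}$ be a Cartier $R$-algebra. Then for every almost Cartier divisor $D$ on $\operatorname{Spec}R$ such that $R(D)$ is a $T$-transposable Cartier $\mathcal{C}$-module, $$T_K\big(f_*\tau(S(f^*D),f^*\mathcal{C})\big)=\tau(R(D),\mathcal{C}).$$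
   Context: $p$ is a prime, $F^e$ the $e$-th iterated Frobenius, $q=p^e$; $f_*$ is restriction of scalars. $\mathbf{G}_1$: the local rings at primes of height $\le1$ are Gorenstein. $\mathbf{S}_k$ for a module $M$: $\operatorname{depth}M_x\ge\min\{k,\dim R_x\}$ for all primes $x$. ''Generically'' means after applying $K\otimes_R-$; it is part of the setup that $L=K\otimes_RS$ is the total ring of fractions of $S$. Under the hypotheses $R$ and $S$ admit canonical modules $\omega_R$ and $\omega_S=\operatorname{Hom}_R(S,\omega_R)$, with $F^!\omega\cong\omega$, where $F^!=\operatorname{Hom}_R(F_*R,-)$. Divisors (Hartshorne). A generalized divisor $D$ on $X=\operatorname{Spec}R$ is a finitely generated $R$-submodule $I_D\subset K$ satisfying $\mathbf{S}_2$ and nonzero at every generic point with $K\otimes I_D\cong K$. It is almost Cartier if $I_D$ is invertible on an open subset of $X$ containing all points of codimension $\le1$. $R(D)=\operatorname{Hom}_R(I_D,R)\cong\{x\in K\mid xI_D\subset R\}\subset K$. For $D$ almost Cartier, $f^*D$ is the almost Cartier divisor on $Y=\operatorname{Spec}S$ with $I_{f^*D}=j_*f_U^*(I_D|_U)$, where $U\subset X$ is such an open subset on which $I_D$ is invertible, $j\colon f^{-1}(U)\to Y$ is the inclusion and $f_U$ the restriction of $f$. One has $S(f^*D)\subset L$. Cartier algebras and modules. A Cartier $R$-algebra is an $\mathbb{N}$-graded ring $\mathcal{C}=\bigoplus_{e\ge0}\mathcal{C}_e$ with $\mathcal{C}_0=R$ and $r\cdot\kappa=\kappa\cdot r^{q}$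 for $r\in R$, $\kappa\in\mathcal{C}_e$; $\mathcal{C}_+=\bigoplus_{e\ge1}\mathcal{C}_e$. A Cartier $\mathcal{C}$-module is a left $\mathcal{C}$-module finitely generated over $R$, i.e. a finitely generated $R$-module $M$ with a homomorphism of Cartier algebras $\mathcal{C}\to\mathcal{C}_M=\bigoplus_e\operatorname{Hom}_R(F^e_*M,M)$ (degree $0$ part replaced by $R$). $f^*\mathcal{C}=\bigoplus_e\mathcal{C}_e\otimes_RS$ is the Cartier $S$-algebra with $s\cdot(\kappa_e\otimes s')=\kappa_e\otimes s^{q}s'$. Transposability. Let $\varsigma\colon S(f^*D)\to f^!R(D)=\operatorname{Hom}_R(S,R(D))$ be $x\mapsto\big(s\mapsto T_K(xs)\big)$ (an injective map). For $\varphi\in\operatorname{Hom}_R(F^e_*R(D),R(D))$ define $\varphi^!\colon F^e_*f^!R(D)\to f^!R(D)$ by $\varphi^!(F^e_*\mu)(s)=\varphi(F^e_*\mu(s^q))$. $\varphi$ is $T$-transposable if there is a (necessarily unique) $\varphi^\top\in\operatorname{Hom}_S(F^e_*S(f^*D),S(f^*D))$ with $\varsigma\circ\varphi^\top=\varphi^!\circ F^e_*\varsigma$. A Cartier $\mathcal{C}$-module structure on $R(D)$ is $T$-transposable if every homogeneous element of $\mathcal{C}$ acts by a $T$-transposable map; then $f^*\mathcal{C}$ acts on $S(f^*D)$ by $\varphi\otimes s\mapsto\varphi^\top\cdot s$, where $(\varphi^\top\cdot s)(F^e_*x)=\varphi^\top(F^e_*sx)$. Test modules. A morphism of Cartier modules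 is a nil-isomorphism if its kernel and cokernel are annihilated by a power of $\mathcal{C}_+$. $\tau(M,\mathcal{C})$ is the smallest Cartier submodule $N\subset M$ such that $H^0_\eta(N_\eta)\to H^0_\eta(M_\eta)$ ($\eta$-power torsion submodules of the localizations) is a nil-isomorphism for all $\eta\in\operatorname{Ass}M$ (existence is presupposed by the notation). *)

(* Defs.v *)
From HB Require Import structures.
From mathcomp Require Import all_boot all_algebra.
From mathcomp Require Import boolp classical_sets functions.
From mathcomp Require Import ring zify.

Set Implicit Arguments.
Unset Strict Implicit.
Unset Printing Implicit Defensive.

Import GRing.Theory.
Local Open Scope classical_set_scope.
Local Open Scope ring_scope.
Local Open Scope quotient_scope.

(* Rings are [comPzRingType]s, so the zero ring is allowed.  A submodule is a
   Prop-valued predicate; [mod_of N] is the submodule N as an lmodType. *)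

Record submod (A : pzRingType) (V : lmodType A) := Submod {
  submod_set :> V -> Prop;
  submod0 : submod_set 0;
  submod_lin : forall a x y,
    submod_set x -> submod_set y -> submod_set (a *: x + y) }.

Section SubmodType.
Variables (A : pzRingType) (V : lmodType A) (N : submod V).

Definition submod_pred : {pred V} := fun x => `[< N x >].

Lemma submod_pred_closed : submod_closed submod_pred.
Proof.
split; first by apply/asboolP; exact: submod0.
by move=> a x y /asboolP Nx /asboolP Ny; apply/asboolP; exact: submod_lin.
Qed.

HB.instance Definition _ :=
  GRing.isSubmodClosed.Build A V submod_pred submod_pred_closed.

Definition mod_of : Type := {x : V | x \in submod_pred}.
HB.instance Definition _ := SubChoice.on mod_of.
HB.instance Definition _ := [SubChoice_isSubLmodule of mod_of by <:].

Lemma mod_ofP (x : mod_of) : N (val x).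
Proof. by case: x => x /= /asboolP. Qed.

Definition to_mod (x : V) (Nx : N x) : mod_of := Sub x (asboolT Nx).

Lemma to_modK (x : V) (Nx : N x) : val (to_mod Nx) = x.
Proof. by rewrite SubK. Qed.

End SubmodType.

(* Restriction of scalars along f (f_* of a module). *)
Definition rscal (A B : pzRingType) (f : {rmorphism A -> B}) (M : lmodType B)
  : Type := M.

Section RestrictionOfScalars.
Variables (A B : pzRingType) (f : {rmorphism A -> B}) (M : lmodType B).

HB.instance Definition _ := GRing.Zmodule.on (rscal f M).

Let rsc (a : A) (x : rscal f M) : rscal f M := f a *: (x : M).

Let rscA a b x : rsc a (rsc b x) = rsc (a * b) x.
Proof. by rewrite /rsc scalerA rmorphM. Qed.
Let rsc1 : left_id 1 rsc.
Proof. by move=> x; rewrite /rsc rmorph1 scale1r. Qed.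
Let rscDr : right_distributive rsc +%R.
Proof. by move=> a x y; rewrite /rsc scalerDr. Qed.
Let rscDl x : {morph rsc^~ x : a b / a + b}.
Proof. by move=> a b; rewrite /rsc rmorphD scalerDl. Qed.

HB.instance Definition _ :=
  GRing.Zmodule_isLmodule.Build A (rscal f M) rscA rsc1 rscDr rscDl.
End RestrictionOfScalars.

Lemma rscalE (A B : pzRingType) (f : {rmorphism A -> B}) (M : lmodType B) a
  (x : rscal f M) : a *: x = f a *: (x : M) :> M.
Proof. by []. Qed.

Lemma rscal_regE (A B : pzRingType) (f : {rmorphism A -> B}) a
  (x : rscal f B^o) : a *: x = f a * (x : B) :> B.
Proof. by []. Qed.

Section RscalSubmod.
Variables (A B : pzRingType) (f : {rmorphism A -> B}) (N : submod (rscal f B^o)).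
Lemma rsub_valD (x y : mod_of N) : val (x + y) = (val x : B) + (val y : B) :> B.
Proof. exact: (raddfD (val : mod_of N -> rscal f B^o)). Qed.
Lemma rsub_valZ a (x : mod_of N) : val (a *: x) = f a * (val x : B) :> B.
Proof. exact: (linearZ_LR (val : mod_of N -> rscal f B^o)). Qed.
End RscalSubmod.

Section Hom.
Variables (R : comPzRingType) (M N : lmodType R).

Lemma hom0 : linear ((0 : M -> N)).
Proof. by move=> a x y; rewrite scaler0 addr0. Qed.
Lemma hom_lin (a : R) (g h : M -> N) :
  linear g -> linear h -> linear (a *: g + h).
Proof.
move=> lg lh b x y.
have e z : (a *: g + h) z = a *: g z + h z by [].
rewrite !e lg lh !scalerDr !scalerA [a * b]mulrC -!addrA; congr (_ + _).
by rewrite addrCA.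
Qed.
(* Hom_R(M, N), inside the R-module of all functions M -> N. *)
Definition hom : submod (M -> N : lmodType R) := Submod hom0 hom_lin.
End Hom.

Record mset (R : comPzRingType) := Mset {
  mset_set :> R -> Prop;
  mset1 : mset_set 1;
  msetM : forall a b, mset_set a -> mset_set b -> mset_set (a * b) }.

(* W^-1 M for a multiplicative set W of R; [frac m w] is m / w.  For an
   R-algebra S, [lalg W f] is W^-1 S as a ring, denominators being taken in R. *)
Section Localization.
Variables (R : comPzRingType) (W : mset R).

Definition den : Type := {w : R | `[< W w >]}.
HB.instance Definition _ := SubChoice.on den.

Definition dval (w : den) : R := val w.
Lemma denP (w : den) : W (dval w).
Proof. by apply/asboolP; exact: (valP w). Qed.
Definition mkden (w : R) (Ww : W w) : den := Sub w (asboolT Ww).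
Definition den1 : den := mkden (mset1 W).
Definition denM (u v : den) : den := mkden (msetM (denP u) (denP v)).

Arguments dval : simpl never.
Lemma dval1 : dval den1 = 1. Proof. by []. Qed.
Lemma dvalM u v : dval (denM u v) = dval u * dval v. Proof. by []. Qed.
Definition dvalE := (dval1, dvalM).

Section Module.
Variable M : lmodType R.

Definition loc_rel (x y : M * den) : bool :=
  `[< exists2 u, W u & (u * dval y.2) *: x.1 = (u * dval x.2) *: y.1 >].

Lemma loc_rel_refl : reflexive loc_rel.
Proof. by move=> x; apply/asboolP; exists 1 => //; exact: mset1. Qed.
Lemma loc_rel_sym : symmetric loc_rel.
Proof.
by move=> x y; apply/asboolP/asboolP => -[u Wu e]; exists u.
Qed.
Lemma loc_rel_trans : transitive loc_rel.
Proof.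
move=> [n t] [m s] [k r] /asboolP[/= u Wu e1] /asboolP[/= v Wv e2].
apply/asboolP; exists (u * v * dval t) => /=.
  by apply: msetM (denP t); exact: msetM.
have -> : u * v * dval t * dval r = v * dval r * (u * dval t) by ring.
have -> : u * v * dval t * dval s = u * dval s * (v * dval t) by ring.
by rewrite -scalerA e1 -[RHS]scalerA -e2 !scalerA mulrC.
Qed.

Canonical loc_equiv := EquivRel loc_rel loc_rel_refl loc_rel_sym loc_rel_trans.

Definition loc : Type := {eq_quot loc_equiv}.
HB.instance Definition _ := EqQuotient.on loc.
HB.instance Definition _ := Choice.on loc.

Definition frac (m : M) (w : den) : loc := \pi_loc (m, w).

Lemma fracW (x : loc) : exists m w, x = frac m w.
Proof. by elim/quotW: x => -[m w]; exists m, w. Qed.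

Lemma frac_eq m n w v : frac m w = frac n v <->
  exists2 u, W u & (u * dval v) *: m = (u * dval w) *: n.
Proof.
rewrite /frac; split.
  by move/eqmodP => /asboolP.
by move=> h; apply/eqmodP/asboolP.
Qed.

Lemma frac_repr (x : loc) : frac (repr x).1 (repr x).2 = x.
Proof. by rewrite /frac -surjective_pairing reprK. Qed.

Lemma frac_reprP m w : exists2 u, W u &
  (u * dval w) *: (repr (frac m w)).1 = (u * dval (repr (frac m w)).2) *: m.
Proof. by apply/frac_eq; rewrite frac_repr. Qed.

Definition loc_add (x y : loc) : loc :=
  frac (dval (repr y).2 *: (repr x).1 + dval (repr x).2 *: (repr y).1)
       (denM (repr x).2 (repr y).2).
Definition loc_opp (x : loc) : loc := frac (- (repr x).1) (repr x).2.

Lemma loc_addE m w n v :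
  loc_add (frac m w) (frac n v) =
  frac (dval v *: m + dval w *: n) (denM w v).
Proof.
rewrite /loc_add; apply/frac_eq; rewrite !dvalE.
have [u Wu eu] := frac_reprP m w; have [t Wt et] := frac_reprP n v.
move: (repr (frac m w)) (repr (frac n v)) eu et => -[m' w'] [n' v'] /= eu et.
exists (u * t); first exact: msetM.
rewrite !scalerDr !scalerA; congr (_ + _).
  have -> : u * t * (dval w * dval v) * dval v' =
            (t * dval v * dval v') * (u * dval w) by ring.
  by rewrite -scalerA eu scalerA; congr (_ *: _); ring.
have -> : u * t * (dval w * dval v) * dval w' =
          (u * dval w * dval w') * (t * dval v) by ring.
by rewrite -scalerA et scalerA; congr (_ *: _); ring.
Qed.

Lemma loc_oppE m w : loc_opp (frac m w) = frac (- m) w.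
Proof.
rewrite /loc_opp; apply/frac_eq; have [u Wu eu] := frac_reprP m w.
by exists u => //; rewrite !scalerN eu.
Qed.

Lemma loc_addA : associative loc_add.
Proof.
move=> x y z; have [m [w ->]] := fracW x; have [n [v ->]] := fracW y.
have [k [r ->]] := fracW z; rewrite !loc_addE; apply/frac_eq.
exists 1; first exact: mset1.
rewrite /= ?dvalE !mulrA; congr (_ *: _); rewrite !scalerDr !scalerA addrA.
by congr (_ + _ + _); congr (_ *: _); rewrite mulrC.
Qed.
Lemma loc_addC : commutative loc_add.
Proof.
move=> x y; have [m [w ->]] := fracW x; have [n [v ->]] := fracW y.
rewrite !loc_addE addrC; apply/frac_eq; exists 1; first exact: mset1.
by rewrite /= ?dvalE [dval w * _]mulrC.
Qed.
Lemma loc_add0 : left_id (frac 0 den1) loc_add.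
Proof.
move=> x; have [m [w ->]] := fracW x.
rewrite loc_addE; apply/frac_eq; exists 1; first exact: mset1.
by rewrite /= ?dvalE scaler0 add0r !mul1r scale1r.
Qed.
Lemma loc_addN : left_inverse (frac 0 den1) loc_opp loc_add.
Proof.
move=> x; have [m [w ->]] := fracW x.
rewrite loc_oppE loc_addE; apply/frac_eq; exists 1; first exact: mset1.
by rewrite scalerN addNr !scaler0.
Qed.

HB.instance Definition _ :=
  GRing.isZmodule.Build loc loc_addA loc_addC loc_add0 loc_addN.

Lemma fracD m w n v :
  frac m w + frac n v = frac (dval v *: m + dval w *: n) (denM w v).
Proof. exact: loc_addE. Qed.

Lemma frac0 w : frac 0 w = 0.
Proof.
by apply/frac_eq; exists 1; [exact: mset1 | rewrite !scaler0].
Qed.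

Lemma fracDr m n w : frac m w + frac n w = frac (m + n) w.
Proof.
rewrite fracD; apply/frac_eq; exists 1; first exact: mset1.
by rewrite -scalerDr scalerA dvalM !mul1r.
Qed.

End Module.
End Localization.
Arguments frac {R W M}.

Section LocalizedAlgebra.
Variables (R : comPzRingType) (W : mset R).
Variables (S : comPzRingType) (f : {rmorphism R -> S}).

Definition lalg : Type := loc W (rscal f S^o).
HB.instance Definition _ := GRing.Zmodule.on lalg.

Definition afrac (s : S) (w : den W) : lalg := frac (s : rscal f S^o) w.

Lemma afrac_eq s t w v : afrac s w = afrac t v <->
  exists2 u, W u & f (u * dval v) * s = f (u * dval w) * t.
Proof. exact: frac_eq. Qed.

Definition lalg_mul (x y : lalg) : lalg :=
  afrac (((repr x).1 : S) * ((repr y).1 : S)) (denM (repr x).2 (repr y).2).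

Lemma lalg_mulE s t w v :
  lalg_mul (afrac s w) (afrac t v) = afrac (s * t) (denM w v).
Proof.
apply/afrac_eq.
have [u Wu eu] := frac_reprP (s : rscal f S^o) w.
have [z Wz ez] := frac_reprP (t : rscal f S^o) v.
rewrite /afrac.
move: (repr (frac (s : rscal f S^o) w)) (repr (frac (t : rscal f S^o) v)) eu ez.
move=> -[s' w'] [t' v'] /=; rewrite !rscal_regE /= => eu ez.
exists (u * z); first exact: msetM.
rewrite ?dvalE.
transitivity (f (u * dval w) * (s' : S) * (f (z * dval v) * (t' : S))).
  by rewrite !rmorphM; ring.
by rewrite eu ez !rmorphM; ring.
Qed.

Lemma lalgW (x : lalg) : exists s w, x = afrac s w.
Proof.
by have [m [w e]] := @fracW R W (rscal f S^o) x; exists m, w.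
Qed.

Lemma afracDE s w t v :
  afrac s w + afrac t v = afrac (f (dval v) * s + f (dval w) * t) (denM w v).
Proof. exact: fracD. Qed.

Lemma lalg_mulA : associative lalg_mul.
Proof.
move=> x y z; have [m [w ->]] := lalgW x; have [n [v ->]] := lalgW y.
have [k [r ->]] := lalgW z; rewrite !lalg_mulE; apply/afrac_eq.
by exists 1; [exact: mset1 | rewrite /= ?dvalE !mulrA].
Qed.
Lemma lalg_mulC : commutative lalg_mul.
Proof.
move=> x y; have [m [w ->]] := lalgW x; have [n [v ->]] := lalgW y.
rewrite !lalg_mulE; apply/afrac_eq.
by exists 1; [exact: mset1 | rewrite /= ?dvalE [n * m]mulrC [dval v * _]mulrC].
Qed.
Lemma lalg_mul1 : left_id (afrac 1 (den1 W)) lalg_mul.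
Proof.
move=> x; have [m [w ->]] := lalgW x; rewrite lalg_mulE; apply/afrac_eq.
by exists 1; [exact: mset1 | rewrite /= ?dvalE !mul1r].
Qed.
Lemma lalg_mulD : left_distributive lalg_mul +%R.
Proof.
move=> x y z; have [m [w ->]] := lalgW x; have [n [v ->]] := lalgW y.
have [k [r ->]] := lalgW z.
rewrite afracDE !lalg_mulE afracDE; apply/afrac_eq.
by exists 1; [exact: mset1 | rewrite /= ?dvalE !rmorphM; ring].
Qed.

HB.instance Definition _ := GRing.Zmodule_isComPzRing.Build lalg
  lalg_mulA lalg_mulC lalg_mul1 lalg_mulD.

Lemma afracM s t w v : afrac s w * afrac t v = afrac (s * t) (denM w v).
Proof. exact: lalg_mulE. Qed.

Definition lalg_in (s : S) : lalg := afrac s (den1 W).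
Lemma lalg_in_zmod : zmod_morphism lalg_in.
Proof.
move=> x y.
have D a b : lalg_in a + lalg_in b = lalg_in (a + b) by exact: fracDr.
have N a : - lalg_in a = lalg_in (- a).
  apply/eqP; rewrite eq_sym -subr_eq0 opprK D addNr; apply/eqP; exact: frac0.
by rewrite N D.
Qed.
Lemma lalg_in_monoid : monoid_morphism lalg_in.
Proof.
split=> // x y; rewrite /lalg_in afracM; apply/afrac_eq.
by exists 1; [exact: mset1 | rewrite /= ?dvalE !rmorphM !rmorph1 !mul1r].
Qed.
HB.instance Definition _ := GRing.isZmodMorphism.Build S lalg lalg_in lalg_in_zmod.
HB.instance Definition _ :=
  GRing.isMonoidMorphism.Build S lalg lalg_in lalg_in_monoid.
End LocalizedAlgebra.
Arguments afrac {R W S f}.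

Definition lring (R : comPzRingType) (W : mset R) : comPzRingType :=
  lalg W (idfun : {rmorphism R -> R}).

Definition lring_in (R : comPzRingType) (W : mset R) : {rmorphism R -> lring W} :=
  @lalg_in R W R idfun.

Section LocalizedModule.
Variables (R : comPzRingType) (W : mset R) (M : lmodType R).

Definition loc_scale (a : lring W) (x : loc W M) : loc W M :=
  frac (((repr a).1 : R) *: (repr x).1) (denM (repr a).2 (repr x).2).

Lemma loc_scaleE (r : R) w m v :
  loc_scale (afrac r w) (frac m v) = frac (r *: m) (denM w v).
Proof.
rewrite /loc_scale; apply/frac_eq.
have [u Wu eu] := frac_reprP (r : rscal idfun R^o) w.
have [z Wz ez] := frac_reprP m v.
rewrite /afrac.
move: (repr (frac (r : rscal idfun R^o) w)) (repr (frac m v)) eu ez.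
move=> -[s' w'] [m' v'] /=; rewrite !rscal_regE /= => eu ez.
exists (u * z); first exact: msetM.
rewrite ?dvalE.
rewrite !scalerA.
have -> : u * z * (dval w * dval v) * s' = (u * dval w * s') * (z * dval v) by ring.
by rewrite eu -scalerA ez scalerA; congr (_ *: _); ring.
Qed.

Lemma loc_scaleA a b x : loc_scale a (loc_scale b x) = loc_scale (a * b) x.
Proof.
have [s [w ->]] := lalgW a; have [t [v ->]] := lalgW b.
have [m [u ->]] := fracW x; rewrite afracM !loc_scaleE; apply/frac_eq.
by exists 1; [exact: mset1 | rewrite /= ?dvalE !scalerA !mulrA].
Qed.
Lemma loc_scale1 : left_id 1 loc_scale.
Proof.
move=> x; have [m [u ->]] := fracW x; rewrite loc_scaleE; apply/frac_eq.
by exists 1; [exact: mset1 | rewrite /= ?dvalE !scalerA !mul1r !mulr1].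
Qed.
Lemma loc_scaleDr : right_distributive loc_scale +%R.
Proof.
move=> a x y; have [s [w ->]] := lalgW a.
have [m [u ->]] := fracW x; have [n [v ->]] := fracW y.
rewrite fracD !loc_scaleE fracD; apply/frac_eq.
exists 1; [exact: mset1 | rewrite /= ?dvalE !scalerDr !scalerA].
by congr (_ *: _ + _ *: _); ring.
Qed.
Lemma loc_scaleDl x : {morph loc_scale^~ x : a b / a + b}.
Proof.
move=> a b; have [s [w ->]] := lalgW a; have [t [v ->]] := lalgW b.
have [m [u ->]] := fracW x.
rewrite afracDE !loc_scaleE fracD; apply/frac_eq.
exists 1; [exact: mset1 | rewrite /= ?dvalE !scalerDl !scalerDr !scalerA].
by congr (_ *: _ + _ *: _); ring.
Qed.
HB.instance Definition _ := GRing.Zmodule_isLmodule.Build (lring W) (loc W M)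
  loc_scaleA loc_scale1 loc_scaleDr loc_scaleDl.

Lemma fracZ r w m v : (afrac r w : lring W) *: frac m v = frac (r *: m) (denM w v).
Proof. exact: loc_scaleE. Qed.
End LocalizedModule.

(* W^-1 g, sending m / w to g m / w.  It is meaningful for linear g only,
   see [loc_mapE]. *)
Definition loc_map (R : comPzRingType) (W : mset R) (M N : lmodType R)
  (g : M -> N) (x : loc W M) : loc W N := frac (g (repr x).1) (repr x).2.

Lemma loc_mapE (R : comPzRingType) (W : mset R) (M N : lmodType R)
  (g : M -> N) m (w : den W) : linear g -> loc_map g (frac m w) = frac (g m) w.
Proof.
move=> lg; have gZ a x : g (a *: x) = a *: g x.
  have g0 : g 0 = 0.
    have := lg (-1) 0 0; rewrite scaler0 addr0 => /eqP.
    by rewrite scaleN1r addrC subrr => /eqP.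
  by rewrite -[a *: x]addr0 lg g0 addr0.
rewrite /loc_map; apply/frac_eq; have [u Wu eu] := frac_reprP m w.
by exists u => //; rewrite -!gZ eu.
Qed.

Definition fg (A : pzRingType) (M : lmodType A) : Prop :=
  exists (n : nat) (g : 'I_n -> M),
    forall x : M, exists c : 'I_n -> A, x = \sum_i c i *: g i.

Definition noetherian (R : comPzRingType) : Prop :=
  forall I : submod R^o, fg (mod_of I).

Definition iso_mod (A : pzRingType) (M N : lmodType A) : Prop :=
  exists g : M -> N, linear g /\ bijective g.

Record spec (R : comPzRingType) := Spec {
  spec_ideal :> submod R^o;
  spec_proper : ~ spec_ideal 1;
  spec_prime : forall a b : R,
    spec_ideal (a * b) -> spec_ideal a \/ spec_ideal b }.

Section SpecMap.
Variables (R S : comPzRingType) (f : {rmorphism R -> S}) (Q : spec S).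

Let pre (a : R^o) : Prop := Q (f a).
Let pre0 : pre 0. Proof. by rewrite /pre rmorph0; exact: submod0. Qed.
Let pre_lin (a : R) x y : pre x -> pre y -> pre (a *: x + y).
Proof.
by rewrite /pre rmorphD rmorphM => Qx Qy; exact: (submod_lin (f a) Qx Qy).
Qed.
Let pre_proper : ~ Submod pre0 pre_lin 1.
Proof. by rewrite /= /pre rmorph1; exact: spec_proper. Qed.
Let pre_prime (a b : R) : Submod pre0 pre_lin (a * b) ->
  Submod pre0 pre_lin a \/ Submod pre0 pre_lin b.
Proof. by rewrite /= /pre rmorphM; exact: spec_prime. Qed.

Definition spec_map : spec R := Spec pre_proper pre_prime.
End SpecMap.

Section Complement.
Variables (R : comPzRingType) (x : spec R).
Let cpl_set (a : R) : Prop := ~ x a.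
Let cpl1 : cpl_set 1. Proof. exact: spec_proper. Qed.
Let cplM (a b : R) : cpl_set a -> cpl_set b -> cpl_set (a * b).
Proof. by move=> na nb /spec_prime[]. Qed.
Definition cpl : mset R := Mset cpl1 cplM.
End Complement.

Section NonZeroDivisors.
Variable R : comPzRingType.
Let nzd_set (a : R) : Prop := forall b, a * b = 0 -> b = 0.
Let nzd1 : nzd_set 1. Proof. by move=> b; rewrite mul1r. Qed.
Let nzdM a b : nzd_set a -> nzd_set b -> nzd_set (a * b).
Proof. by move=> ha hb c; rewrite -mulrA => /ha /hb. Qed.
Definition nzd : mset R := Mset nzd1 nzdM.
End NonZeroDivisors.

Section Powers.
Variables (R : comPzRingType) (a : R).
Let pow_set (b : R) : Prop := exists n, b = a ^+ n.
Let pow1 : pow_set 1. Proof. by exists 0%N; rewrite expr0. Qed.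
Let powM b c : pow_set b -> pow_set c -> pow_set (b * c).
Proof. by move=> [n ->] [m ->]; exists (n + m)%N; rewrite exprD. Qed.
Definition powers : mset R := Mset pow1 powM.
End Powers.

Definition maximal (R : comPzRingType) (m : submod R^o) : Prop :=
  ~ m 1 /\ forall J : submod R^o,
    (forall a, m a -> J a) -> ~ J 1 -> forall a, J a -> m a.

Definition is_local (R : comPzRingType) : Prop :=
  exists m : submod R^o, maximal m /\
    forall m' : submod R^o, maximal m' -> forall a, m' a <-> m a.

(* R is generated as a ring by the image of a field and finitely many elements. *)
Definition finite_type_over_field (R : comPzRingType) : Prop :=
  exists (k : fieldType) (i : {rmorphism k -> R}) (g : seq R),
  forall P : R -> Prop, P 1 -> (forall a b, P a -> P b -> P (a - b)) ->
    (forall a b, P a -> P b -> P (a * b)) -> (forall c, P (i c)) ->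
    (forall a, a \in g -> P a) -> forall a, P a.

Definition finite_morphism (R S : comPzRingType) (f : {rmorphism R -> S}) :=
  fg (rscal f S^o).

(* Every nonempty basic open set D(a) of Spec R meets the image of Spec S. *)
Definition dominant (R S : comPzRingType) (f : {rmorphism R -> S}) : Prop :=
  forall a : R, (exists x : spec R, ~ x a) ->
    exists Q : spec S, ~ spec_map f Q a.

Definition Fp_algebra (p : nat) (R : comPzRingType) : Prop :=
  prime p /\ p%:R = 0 :> R.

(* F_* R is a finitely generated R-module. *)
Definition F_finite (p : nat) (R : comPzRingType) : Prop :=
  exists (n : nat) (g : 'I_n -> R),
    forall a : R, exists c : 'I_n -> R, a = \sum_i c i ^+ p * g i.

(* dim A >= n. *)
Definition krull_dim_ge (A : comPzRingType) (n : nat) : Prop :=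
  exists x : nat -> spec A, forall i, (i < n)%N ->
    (forall a, x i a -> x i.+1 a) /\ exists2 a, x i.+1 a & ~ x i a.

Section Depth.
Variables (A : comPzRingType) (M : lmodType A).

(* z lies in (s) M. *)
Definition in_span (s : seq A) (z : M) : Prop :=
  exists m : nat -> M, z = \sum_(i < size s) s`_i *: m i.

Definition regular_seq (s : seq A) : Prop :=
  (forall i, (i < size s)%N ->
     forall z, in_span (take i s) (s`_i *: z) -> in_span (take i s) z) /\
  exists z, ~ in_span s z.

(* depth M >= n over a local ring A, whose maximal ideal is the set of
   non-units; the depth of the zero module is infinite. *)
Definition depth_ge (n : nat) : Prop :=
  (forall z : M, z = 0) \/
  exists s : seq A, size s = n /\
    (forall a, a \in s -> ~ exists b, a * b = 1) /\ regular_seq s.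
End Depth.

(* depth M_x >= min (k, dim R_x) for all x. *)
Definition serre_S (k : nat) (R : comPzRingType) (M : lmodType R) : Prop :=
  forall (x : spec R) (n : nat), (n <= k)%N ->
    krull_dim_ge (lring (cpl x)) n -> depth_ge (loc (cpl x) M) n.

Definition injective_mod (A : comPzRingType) (I : lmodType A) : Prop :=
  forall (M N : lmodType A) (i : M -> N) (g : M -> I),
    linear i -> injective i -> linear g ->
    exists h : N -> I, linear h /\ forall m, h (i m) = g m.

(* M has an injective resolution of length at most n. *)
Inductive injdim_le (A : comPzRingType) : nat -> lmodType A -> Prop :=
| Injdim0 (M : lmodType A) : injective_mod M -> injdim_le 0 M
| InjdimS n (M I Q : lmodType A) (i : M -> I) (q : I -> Q) :
    injective_mod I -> linear i -> linear q ->
    injective i -> (forall y, q y = 0 <-> exists m, y = i m) ->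
    (forall z, exists y, q y = z) -> injdim_le n Q -> injdim_le n.+1 M.

(* A has finite injective dimension over itself; used for noetherian local A. *)
Definition gorenstein_local (A : comPzRingType) : Prop :=
  exists n, injdim_le n (A^o : lmodType A).

Definition G1 (R : comPzRingType) : Prop :=
  forall x : spec R, ~ krull_dim_ge (lring (cpl x)) 2 ->
    gorenstein_local (lring (cpl x)).

(* K is the total ring of fractions of R, and K (x)_R M is the localization of
   M at the non-zero-divisors of R.  In particular L = K (x)_R S has its
   denominators in R; that L is the total ring of fractions of S is
   [is_total_fraction_ring (inL f)]. *)
Definition Ktot (R : comPzRingType) : comPzRingType := lring (nzd R).
Definition inK (R : comPzRingType) : {rmorphism R -> Ktot R} := lring_in (nzd R).
Definition Ltot (R S : comPzRingType) (f : {rmorphism R -> S}) : comPzRingType :=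
  lalg (nzd R) f.
Definition inL (R S : comPzRingType) (f : {rmorphism R -> S}) :
  {rmorphism S -> Ltot f} := lalg_in (nzd R) f.
Definition KtoL (R S : comPzRingType) (f : {rmorphism R -> S}) :
  Ktot R -> Ltot f :=
  @loc_map R (nzd R) (rscal idfun R^o) (rscal f S^o) f.

Definition is_total_fraction_ring (S L : comPzRingType)
  (i : {rmorphism S -> L}) : Prop :=
  injective i /\ (forall s, nzd S s -> exists y, i s * y = 1) /\
  (forall y, exists s t, nzd S t /\ y * i t = i s).
(* K as an R-module and L as an S-module. *)
Notation Kmod R := (rscal (inK R) (Ktot R)^o).
Notation Lmod f := (rscal (inL f) (Ltot f)^o).

Definition generic_point (R : comPzRingType) (x : spec R) : Prop :=
  forall y : spec R, (forall a, y a -> x a) -> forall a, x a -> y a.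

Record gen_divisor (R : comPzRingType) (I : submod (Kmod R)) : Prop := {
  gen_divisor_fg : fg (mod_of I);
  gen_divisor_S2 : serre_S 2 (mod_of I);
  gen_divisor_neq0 : forall x : spec R, generic_point x ->
    exists z : loc (cpl x) (mod_of I), z <> 0;
  gen_divisor_K : iso_mod (loc (nzd R) (mod_of I)) (Ktot R)^o }.

(* U is open in Spec R: the complement of V(A). *)
Definition zopen (R : comPzRingType) (U : spec R -> Prop) : Prop :=
  exists A : R -> Prop, forall x, U x <-> exists2 a, A a & ~ x a.

(* The sheaf of M is locally free of rank 1 on U. *)
Definition invertible_on (R : comPzRingType) (M : lmodType R)
  (U : spec R -> Prop) : Prop :=
  forall x, U x -> exists2 a, ~ x a &
    iso_mod (loc (powers a) M) (lring (powers a))^o.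

Definition almost_cartier_on (R : comPzRingType) (I : submod (Kmod R))
  (U : spec R -> Prop) : Prop :=
  zopen U /\ (forall x, ~ krull_dim_ge (lring (cpl x)) 2 -> U x) /\
  invertible_on (mod_of I) U.

(* { x in B | x J is contained in A }: this is R(D) for J = I_D. *)
Section Colon.
Variables (A B : comPzRingType) (i : {rmorphism A -> B}) (J : submod (rscal i B^o)).
Let colon_set (x : rscal i B^o) : Prop :=
  forall a, J a -> exists b, (x : B) * (a : B) = i b.
Let colon0 : colon_set 0.
Proof. by move=> a _; exists 0; rewrite mul0r rmorph0. Qed.
Let colon_lin (r : A) x y : colon_set x -> colon_set y -> colon_set (r *: x + y).
Proof.
move=> hx hy a Ja; have [b eb] := hx a Ja; have [c ec] := hy a Ja.
exists (r * b + c); rewrite rmorphD rmorphM -eb -ec.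
by rewrite rscal_regE mulrDl mulrA.
Qed.
Definition colon : submod (rscal i B^o) := Submod colon0 colon_lin.
End Colon.

Section PullbackDivisor.
Variables (R S : comPzRingType) (f : {rmorphism R -> S}).
Variables (I : submod (Kmod R)) (U : spec R -> Prop).

(* The S-submodule I S of L. *)
Inductive ext_set : Ltot f -> Prop :=
| ext0 : ext_set 0
| extD (s : S) (a : Ktot R) y : I a -> ext_set y ->
    ext_set (inL f s * KtoL f a + y).

Lemma ext_add x y : ext_set x -> ext_set y -> ext_set (x + y).
Proof.
move=> ex ey; elim: ex => [|s a z Ia _ ez]; first by rewrite add0r.
by rewrite -addrA; exact: extD.
Qed.
Lemma ext_scale s x : ext_set x -> ext_set (inL f s * x).
Proof.
elim=> [|t a z Ia _ ez]; first by rewrite mulr0; exact: ext0.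
by rewrite mulrDr mulrA -rmorphM; exact: extD.
Qed.
Lemma ext_in a : I a -> ext_set (KtoL f a).
Proof.
by move=> Ia; have := extD 1 Ia ext0; rewrite rmorph1 mul1r addr0.
Qed.

(* The global sections of j_* f_U^* (I|_U) as a submodule of L: the x in L that
   lie in the stalk (I S)_Q at each point Q of f^-1(U), i.e. some s outside Q
   satisfies s x \in I S. *)
Let pull_set (x : Lmod f) : Prop := forall Q : spec S, U (spec_map f Q) ->
  exists2 s, ~ Q s & ext_set (inL f s * x).
Let pull0 : pull_set 0.
Proof.
by move=> Q _; exists 1; [exact: spec_proper | rewrite mulr0; exact: ext0].
Qed.
Let pull_lin (a : S) x y : pull_set x -> pull_set y -> pull_set (a *: x + y).
Proof.
move=> hx hy Q UQ; have [s Qs hs] := hx Q UQ; have [t Qt ht] := hy Q UQ.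
exists (s * t); first by move=> /spec_prime[].
rewrite rscal_regE mulrDr; apply: ext_add.
  have -> : inL f (s * t) * (inL f a * x) =
    inL f (t * a) * (inL f s * x) by rewrite !rmorphM; ring.
  exact: ext_scale.
by rewrite rmorphM -mulrA; exact: ext_scale.
Qed.
Definition pull_div : submod (Lmod f) := Submod pull0 pull_lin.
End PullbackDivisor.

Definition omega (R S : comPzRingType) (f : {rmorphism R -> S}) :
  submod (rscal f S^o -> R^o) := hom (rscal f S^o) R^o.

Section Trace.
Variables (R S : comPzRingType) (f : {rmorphism R -> S}) (T : mod_of (omega f)).

Lemma twist_linear (s : S) : omega f (fun t : rscal f S^o => val T (s * t)).
Proof.
move=> r x y; rewrite -(mod_ofP T); congr (val T _).
by rewrite !rscal_regE mulrDr mulrCA.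
Qed.
(* s . T, that is t |-> T(s t). *)
Definition twist (s : rscal f S^o) : mod_of (omega f) := to_mod (twist_linear s).

(* K (x)_R - turns S -> omega_{S/R}, 1 |-> T, into an isomorphism. *)
Definition generically_iso : Prop := bijective (@loc_map R (nzd R) _ _ twist).

Definition TK : Ltot f -> Ktot R :=
  @loc_map R (nzd R) (rscal f S^o) (rscal idfun R^o) (val T).

End Trace.

Lemma Fp_exprD p (R : comPzRingType) e (x y : R) : Fp_algebra p R ->
  (x + y) ^+ (p ^ e) = x ^+ (p ^ e) + y ^+ (p ^ e).
Proof.
move=> [p_pr p0]; elim: e x y => [|e IH] x y; first by rewrite expn0 !expr1.
have D (a b : R) : (a + b) ^+ p = a ^+ p + b ^+ p.
  clear IH x y; case: p p_pr p0 => // k p_pr p0.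
  rewrite exprDn big_ord_recr big_ord_recl /= subn0 subnn bin0 binn.
  rewrite !expr0 mulr1 mul1r !mulr1n big1 ?addr0 //= => i _.
  have /dvdnP[j ->] : (k.+1 %| 'C(k.+1, bump 0 i))%N.
    by apply: prime_dvd_bin => //=; rewrite ltnS.
  by rewrite mulrnA -mulr_natr p0 mulr0.
by rewrite expnSr !exprM IH D.
Qed.

(* An N-graded ring with degree 0 part R, given by its homogeneous components.
   The product takes a proof of e + e' = n, so that associativity and the unit
   laws need no transport. *)
Record cartier_algebra (p : nat) (R : comPzRingType) (FpR : Fp_algebra p R) :=
CartierAlgebra {
  ccomp :> nat -> zmodType;
  cmul : forall e e' n, (e + e')%N = n -> ccomp e -> ccomp e' -> ccomp n;
  cstr : R -> ccomp 0;
  cmulDl : forall e e' n (h : (e + e')%N = n) y,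
    {morph (cmul h)^~ y : x x' / x + x'};
  cmulDr : forall e e' n (h : (e + e')%N = n) x,
    {morph cmul h x : y y' / y + y'};
  cmulA : forall e1 e2 e3 e12 e23 n (h12 : (e1 + e2)%N = e12)
    (h23 : (e2 + e3)%N = e23) (h : (e1 + e23)%N = n) (h' : (e12 + e3)%N = n)
    x y z, cmul h x (cmul h23 y z) = cmul h' (cmul h12 x y) z;
  cmul1l : forall e (h : (0 + e)%N = e), left_id (cstr 1) (cmul h);
  cmul1r : forall e (h : (e + 0)%N = e), right_id (cstr 1) (cmul h);
  cstrD : {morph cstr : r s / r + s};
  cstrM : forall h, {morph cstr : r s / r * s >-> cmul h r s};
  cstr_bij : bijective cstr;
  cstrC : forall e (h : (0 + e)%N = e) (h' : (e + 0)%N = e) (r : R) x,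
    cmul h (cstr r) x = cmul h' x (cstr (r ^+ (p ^ e))) }.
Arguments cmul {p R FpR} C {e e' n} h x y : rename.
Arguments cstr {p R FpR} C r : rename.

(* The tensor product of a right I-set A and a left I-set B (abelian groups with
   additive actions): formal sums of pairs, two of them being identified when
   every balanced biadditive map takes the same value on both. *)
Section Tensor.
Variables (I : Type) (A B : zmodType) (ra : A -> I -> A) (lb : I -> B -> B).

Definition balanced (Z : zmodType) (b : A -> B -> Z) : Prop :=
  [/\ forall y, {morph b^~ y : x x' / x + x'},
      forall x, {morph b x : y y' / y + y'} &
      forall x r y, b (ra x r) y = b x (lb r y)].

Definition tval (Z : zmodType) (b : A -> B -> Z) (l : seq (A * B)) : Z :=
  \sum_(x <- l) b x.1 x.2.

Definition tensor_rel (l l' : seq (A * B)) : bool :=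
  `[< forall (Z : zmodType) (b : A -> B -> Z),
        balanced b -> tval b l = tval b l' >].

Lemma tensor_rel_refl : reflexive tensor_rel.
Proof. by move=> l; apply/asboolP. Qed.
Lemma tensor_rel_sym : symmetric tensor_rel.
Proof. by move=> l l'; apply/asboolP/asboolP => h Z b bb; rewrite h. Qed.
Lemma tensor_rel_trans : transitive tensor_rel.
Proof.
move=> l' l l'' /asboolP h /asboolP h'; apply/asboolP => Z b bb.
by rewrite h ?h'.
Qed.

Canonical tensor_equiv :=
  EquivRel tensor_rel tensor_rel_refl tensor_rel_sym tensor_rel_trans.

Definition tensor : Type := {eq_quot tensor_equiv}.
HB.instance Definition _ := EqQuotient.on tensor.
HB.instance Definition _ := Choice.on tensor.

Definition tens_seq (l : seq (A * B)) : tensor := \pi_tensor l.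
Definition tens (x : A) (y : B) : tensor := tens_seq [:: (x, y)].

Lemma tens_seq_eq l l' : tens_seq l = tens_seq l' <->
  forall (Z : zmodType) (b : A -> B -> Z), balanced b -> tval b l = tval b l'.
Proof.
rewrite /tens_seq; split; first by move/eqmodP/asboolP.
by move=> h; apply/eqmodP/asboolP.
Qed.

Lemma tens_seq_repr t : tens_seq (repr t) = t.
Proof. exact: reprK. Qed.

Lemma tval_repr (Z : zmodType) (b : A -> B -> Z) l :
  balanced b -> tval b (repr (tens_seq l)) = tval b l.
Proof.
by move=> bb; have /tens_seq_eq/(_ Z b bb) := tens_seq_repr (tens_seq l).
Qed.

Lemma tval_cat (Z : zmodType) (b : A -> B -> Z) l l' :
  tval b (l ++ l') = tval b l + tval b l'.
Proof. exact: big_cat. Qed.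

Definition tneg (l : seq (A * B)) := [seq (- x.1, x.2) | x <- l].

Lemma tval_neg (Z : zmodType) (b : A -> B -> Z) l :
  balanced b -> tval b (tneg l) = - tval b l.
Proof.
move=> [bl _ _]; rewrite /tval big_map -sumrN; apply: eq_bigr => x _ /=.
apply/eqP; rewrite -addr_eq0 -bl addNr; apply/eqP.
by apply: (@addIr _ (b 0 x.2)); rewrite -bl !add0r.
Qed.

Definition tensor_add (t u : tensor) := tens_seq (repr t ++ repr u).
Definition tensor_opp (t : tensor) := tens_seq (tneg (repr t)).

Lemma tensor_addE l l' :
  tensor_add (tens_seq l) (tens_seq l') = tens_seq (l ++ l').
Proof.
by apply/tens_seq_eq => Z b bb; rewrite !tval_cat !tval_repr.
Qed.
Lemma tensor_oppE l : tensor_opp (tens_seq l) = tens_seq (tneg l).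
Proof.
by apply/tens_seq_eq => Z b bb; rewrite !tval_neg // tval_repr.
Qed.

Lemma tensor_addA : associative tensor_add.
Proof.
move=> t u v; rewrite -[t]tens_seq_repr -[u]tens_seq_repr -[v]tens_seq_repr.
by rewrite !tensor_addE catA.
Qed.
Lemma tensor_addC : commutative tensor_add.
Proof.
move=> t u; rewrite -[t]tens_seq_repr -[u]tens_seq_repr !tensor_addE.
by apply/tens_seq_eq => Z b bb; rewrite !tval_cat addrC.
Qed.
Lemma tensor_add0 : left_id (tens_seq [::]) tensor_add.
Proof. by move=> t; rewrite -[t]tens_seq_repr tensor_addE. Qed.
Lemma tensor_addN : left_inverse (tens_seq [::]) tensor_opp tensor_add.
Proof.
move=> t; rewrite -[t]tens_seq_repr tensor_oppE tensor_addE.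
apply/tens_seq_eq => Z b bb.
by rewrite tval_cat tval_neg // addNr /tval big_nil.
Qed.

HB.instance Definition _ := GRing.isZmodule.Build tensor
  tensor_addA tensor_addC tensor_add0 tensor_addN.

Definition tlift (Z : zmodType) (b : A -> B -> Z) (t : tensor) : Z :=
  tval b (repr t).

Lemma tliftE (Z : zmodType) (b : A -> B -> Z) x y :
  balanced b -> tlift b (tens x y) = b x y.
Proof. by move=> bb; rewrite /tlift tval_repr // /tval big_seq1. Qed.

Lemma tliftD (Z : zmodType) (b : A -> B -> Z) :
  balanced b -> {morph tlift b : t u / t + u}.
Proof.
move=> bb t u; rewrite -[t]tens_seq_repr -[u]tens_seq_repr.
have -> : tens_seq (repr t) + tens_seq (repr u) =
  tens_seq (repr t ++ repr u) by exact: tensor_addE.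
by rewrite /tlift !tval_repr // tval_cat.
Qed.

Lemma tens_balanced : balanced (tens : A -> B -> tensor).
Proof.
split=> [y x x'|x y y'|x r y].
- have -> : tens x y + tens x' y = tens_seq [:: (x, y); (x', y)].
    exact: tensor_addE.
  apply/tens_seq_eq => Z b [bl _ _].
  by rewrite /tval !(big_cons, big_nil) /= !addr0 bl.
- have -> : tens x y + tens x y' = tens_seq [:: (x, y); (x, y')].
    exact: tensor_addE.
  apply/tens_seq_eq => Z b [_ br _].
  by rewrite /tval !(big_cons, big_nil) /= !addr0 br.
- by apply/tens_seq_eq => Z b [_ _ bb]; rewrite /tval !(big_cons, big_nil) /= bb.
Qed.

Lemma tensD x x' y : tens (x + x') y = tens x y + tens x' y.
Proof. by case: tens_balanced => h _ _; exact: h. Qed.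
Lemma tensDr x y y' : tens x (y + y') = tens x y + tens x y'.
Proof. by case: tens_balanced => _ h _; exact: h. Qed.
Lemma tens_bal x r y : tens (ra x r) y = tens x (lb r y).
Proof. by case: tens_balanced. Qed.

Lemma tensor_ind (P : tensor -> Prop) : P 0 ->
  (forall x y t, P t -> P (tens x y + t)) -> forall t, P t.
Proof.
move=> P0 PD t; rewrite -[t]tens_seq_repr; elim: (repr t) => [|[x y] l IH] //.
have -> : tens_seq ((x, y) :: l) = tens x y + tens_seq l.
  by rewrite -cat1s; symmetry; exact: tensor_addE.
exact: PD.
Qed.

Lemma morphD0 (Z Z' : zmodType) (g : Z -> Z') :
  {morph g : x y / x + y} -> g 0 = 0.
Proof. by move=> gD; apply: (@addIr _ (g 0)); rewrite -gD !add0r. Qed.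

Lemma tensor_ext (Z : zmodType) (g h : tensor -> Z) :
  {morph g : x y / x + y} -> {morph h : x y / x + y} ->
  (forall x y, g (tens x y) = h (tens x y)) -> g =1 h.
Proof.
move=> gD hD e; elim/tensor_ind => [|x y t IH]; first by rewrite !morphD0.
by rewrite gD hD e IH.
Qed.
End Tensor.

(* f^* C: the component of degree e is C_e (x)_R S for the right R-module
   structure of C_e, with
   (k (x) s) (k' (x) s') = k k' (x) s^(p^e') s' for k' of degree e'. *)
Section PullbackAlgebra.
Variables (p : nat) (R S : comPzRingType) (f : {rmorphism R -> S}).
Variables (FpR : Fp_algebra p R) (FpS : Fp_algebra p S).
Variable C : cartier_algebra FpR.

Definition pb_ract e (x : C e) (r : R) : C e := cmul C (addn0 e) x (cstr C r).
Definition pb_lact (r : R) (s : S) : S := f r * s.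

Definition pb_comp (e : nat) : zmodType := tensor (@pb_ract e) pb_lact.
Definition ptens e (x : C e) (s : S) : pb_comp e := tens _ _ x s.

Definition pb_bil e e' n (h : (e + e')%N = n) (x : C e) (s : S) (y : C e')
  (t : S) : pb_comp n := ptens (cmul C h x y) (s ^+ (p ^ e') * t).

Lemma pb_bil_bal e e' n (h : (e + e')%N = n) x s :
  balanced (@pb_ract e') pb_lact (pb_bil h x s).
Proof.
split=> [t y y'|y t t'|y r t]; rewrite /pb_bil /ptens.
- by rewrite cmulDr tensD.
- by rewrite mulrDr tensDr.
- rewrite /pb_ract (cmulA h (addn0 e') h (addn0 n)) tens_bal.
  by congr tens; rewrite /pb_lact mulrCA.
Qed.

Definition pb_half e e' n (h : (e + e')%N = n) (u : pb_comp e') (x : C e) (s : S)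
  : pb_comp n := tlift (pb_bil h x s) u.

Lemma pb_halfE e e' n (h : (e + e')%N = n) y t x s :
  pb_half h (ptens y t) x s = pb_bil h x s y t.
Proof. exact: (tliftE _ _ (pb_bil_bal h x s)). Qed.

Lemma pb_half_bal e e' n (h : (e + e')%N = n) (u : pb_comp e') :
  balanced (@pb_ract e) pb_lact (pb_half h u).
Proof.
have hD x s := tliftD (pb_bil_bal h x s).
split=> [s x x'|x s s'|x r s]; move: u.
- apply: tensor_ext => [|u v|y t]; first exact: hD.
    by rewrite /pb_half !hD addrACA.
  by rewrite !pb_halfE /pb_bil cmulDl /ptens tensD.
- apply: tensor_ext => [|u v|y t]; first exact: hD.
    by rewrite /pb_half !hD addrACA.
  by rewrite !pb_halfE /pb_bil Fp_exprD // mulrDl /ptens tensDr.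
- apply: tensor_ext => [||y t]; try exact: hD.
  rewrite !pb_halfE /pb_bil /pb_ract.
  rewrite -(cmulA (addn0 e) (add0n e') h h) (cstrC (add0n e') (addn0 e')).
  rewrite (cmulA h (addn0 e') h (addn0 n)) /ptens tens_bal.
  by congr tens; rewrite /pb_lact exprMn -rmorphXn mulrA.
Qed.

Definition pb_mul e e' n (h : (e + e')%N = n) (u : pb_comp e) (v : pb_comp e')
  : pb_comp n := tlift (pb_half h v) u.

Lemma pb_mulE e e' n (h : (e + e')%N = n) x s y t :
  pb_mul h (ptens x s) (ptens y t) =
  ptens (cmul C h x y) (s ^+ (p ^ e') * t).
Proof.
by rewrite /pb_mul (tliftE _ _ (pb_half_bal h _)) pb_halfE.
Qed.

Definition pb_str (s : S) : pb_comp 0 := ptens (cstr C 1) s.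

Lemma pb_mulDl e e' n (h : (e + e')%N = n) v :
  {morph (@pb_mul _ _ _ h)^~ v : u u' / u + u'}.
Proof. exact: (tliftD (pb_half_bal h v)). Qed.
Lemma pb_mulDr e e' n (h : (e + e')%N = n) u :
  {morph pb_mul h u : v v' / v + v'}.
Proof.
move=> v v'; move: u; apply: tensor_ext => [|u u'|x s]; first exact: pb_mulDl.
  by rewrite !pb_mulDl addrACA.
have E w : pb_mul h (tens _ _ x s) w = pb_half h w x s.
  exact: (tliftE _ _ (pb_half_bal h w)).
rewrite !E; exact: (tliftD (pb_bil_bal h x s)).
Qed.
Lemma pb_mulA e1 e2 e3 e12 e23 n (h12 : (e1 + e2)%N = e12)
    (h23 : (e2 + e3)%N = e23) (h : (e1 + e23)%N = n) (h' : (e12 + e3)%N = n)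
    u v w : pb_mul h u (pb_mul h23 v w) = pb_mul h' (pb_mul h12 u v) w.
Proof.
move: w; apply: tensor_ext => [w w'|w w'|z r]; rewrite ?pb_mulDr //.
move: v; apply: tensor_ext => [v v'|v v'|y t].
- by rewrite pb_mulDl pb_mulDr.
- by rewrite pb_mulDr pb_mulDl.
move: u; apply: tensor_ext => [u u'|u u'|x s]; rewrite ?pb_mulDl //.
rewrite !pb_mulE (cmulA h12 h23 h h'); congr ptens.
by rewrite exprMn -exprM -expnD mulrA h23.
Qed.
Lemma pb_mul1l e (h : (0 + e)%N = e) : left_id (pb_str 1) (@pb_mul _ _ _ h).
Proof.
move=> u; move: u; apply: tensor_ext => [u u'|//|x s]; first exact: pb_mulDr.
by rewrite pb_mulE cmul1l expr1n mul1r.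
Qed.
Lemma pb_mul1r e (h : (e + 0)%N = e) : right_id (pb_str 1) (@pb_mul _ _ _ h).
Proof.
move=> u; move: u; apply: tensor_ext => [u u'|//|x s]; first exact: pb_mulDl.
by rewrite pb_mulE cmul1r expn0 expr1 mulr1.
Qed.
Lemma pb_strD : {morph pb_str : r s / r + s}.
Proof. by move=> r s; rewrite /pb_str /ptens tensDr. Qed.
Lemma pb_strM h : {morph pb_str : r s / r * s >-> @pb_mul 0 0 0 h r s}.
Proof. by move=> r s; rewrite /= pb_mulE cmul1l expn0 expr1. Qed.
Lemma pb_str_bij : bijective pb_str.
Proof.
have [g gK Kg] := cstr_bij C.
have gD : {morph g : x y / x + y}.
  by move=> x y; apply: (can_inj gK); rewrite cstrD !Kg.
have gM x r : g (pb_ract x r) = g x * r.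
  by apply: (can_inj gK); rewrite Kg (cstrM C (addn0 0)) Kg.
pose b (x : C 0) (s : S) : S := f (g x) * s.
have bb : balanced (@pb_ract 0) pb_lact b.
  split=> [y x x'|x y y'|x r y]; rewrite /b.
  - by rewrite gD rmorphD mulrDl.
  - by rewrite mulrDr.
  - by rewrite gM rmorphM /pb_lact mulrA.
exists (tlift b) => [s|u].
  by rewrite /pb_str (tliftE _ _ bb) /b gK rmorph1 mul1r.
move: u; apply: tensor_ext => [u u'|//|x s].
  by rewrite tliftD // pb_strD.
rewrite (tliftE _ _ bb) /b /pb_str -[f (g x) * s]/(pb_lact (g x) s) /ptens.
by rewrite -tens_bal /pb_ract cmul1l Kg.
Qed.
Lemma pb_strC e (h : (0 + e)%N = e) (h' : (e + 0)%N = e) (r : S) u :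
  pb_mul h (pb_str r) u = pb_mul h' u (pb_str (r ^+ (p ^ e))).
Proof.
move: u; apply: tensor_ext => [u u'|u u'|x s].
- exact: pb_mulDr.
- exact: pb_mulDl.
by rewrite !pb_mulE cmul1l cmul1r expn0 expr1 mulrC.
Qed.

Definition pullback_algebra : cartier_algebra FpS :=
  @CartierAlgebra p S FpS pb_comp pb_mul pb_str pb_mulDl pb_mulDr pb_mulA pb_mul1l pb_mul1r pb_strD pb_strM
    pb_str_bij pb_strC.
End PullbackAlgebra.

Section CartierModules.
Variables (p : nat) (R : comPzRingType) (FpR : Fp_algebra p R).
Variable C : cartier_algebra FpR.

(* A left C-module structure on M whose restriction to C_0 = R is the given
   R-module structure; C_e then acts by elements of Hom_R(F^e_* M, M), see
   [cact_frob]. *)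
Record cartier_action (M : lmodType R) := CartierAction {
  cact : forall e, C e -> M -> M;
  cactDl : forall e m, {morph (@cact e)^~ m : x y / x + y};
  cactDr : forall e x, {morph @cact e x : m n / m + n};
  cactM : forall e e' n (h : (e + e')%N = n) x y m,
    cact (cmul C h x y) m = cact x (cact y m);
  cactZ : forall r m, cact (cstr C r) m = r *: m }.
Arguments cact {M} a {e} x m : rename.

Lemma cact_frob (M : lmodType R) (a : cartier_action M) e (x : C e) r m :
  r *: cact a x m = cact a x (r ^+ (p ^ e) *: m).
Proof.
by rewrite -(cactZ a) -(cactM a (add0n e)) (cstrC _ (addn0 e)) cactM cactZ.
Qed.

Record cartier_submod (M : lmodType R) (a : cartier_action M) :=
CartierSubmod {
  csub :> submod M;
  csub_stable : forall e (x : C e) m, csub m -> csub (cact a x m) }.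

Section Restrict.
Variables (M : lmodType R) (a : cartier_action M) (N : cartier_submod a).

Definition sub_cact e (x : C e) (m : mod_of N) : mod_of N :=
  to_mod (csub_stable x (mod_ofP m)).

Lemma sub_cactDl e m : {morph (@sub_cact e)^~ m : x y / x + y}.
Proof. by move=> x y; apply: val_inj; exact: cactDl. Qed.
Lemma sub_cactDr e x : {morph @sub_cact e x : m n / m + n}.
Proof. by move=> m n; apply: val_inj; exact: cactDr. Qed.
Lemma sub_cactM e e' n (h : (e + e')%N = n) x y m :
  sub_cact (cmul C h x y) m = sub_cact x (sub_cact y m).
Proof. by apply: val_inj; exact: cactM. Qed.
Lemma sub_cactZ r m : sub_cact (cstr C r) m = r *: m.
Proof. by apply: val_inj; exact: cactZ. Qed.

Definition sub_action : cartier_action (mod_of N) :=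
  CartierAction sub_cactDl sub_cactDr sub_cactM sub_cactZ.
End Restrict.

Section Localize.
Variables (M : lmodType R) (a : cartier_action M) (W : mset R).

Definition locR : lmodType R := rscal (lring_in W) (loc W M).

(* C acts on M_W by k (m / w) = k (w^(p^e - 1) m) / w. *)
Definition loc_cact e (x : C e) (z : locR) : locR :=
  let: (m, w) := repr (z : loc W M) in
  frac (cact a x (dval w ^+ (p ^ e).-1 *: m)) w.

Let q_gt0 e : (0 < p ^ e)%N.
Proof. by rewrite expn_gt0 prime_gt0 //; case: FpR. Qed.

Lemma loc_cactE e (x : C e) m (w : den W) :
  loc_cact x (frac m w) = frac (cact a x (dval w ^+ (p ^ e).-1 *: m)) w.
Proof.
rewrite /loc_cact; have [u Wu] := frac_reprP m w.
case: (repr _) => m' w' /= eu; apply/frac_eq; exists u => //.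
rewrite !cact_frob !scalerA.
move: (prednK (q_gt0 e)); set q := (p ^ e)%N => qE.
have E (c d : R) : (u * c) ^+ q * d ^+ q.-1 =
    u ^+ q.-1 * c ^+ q.-1 * d ^+ q.-1 * (u * c).
  by rewrite -{1}qE exprS exprMn; ring.
by rewrite !E -scalerA eu scalerA; congr (cact a x (_ *: _)); ring.
Qed.

Lemma loc_cactDl e z : {morph (@loc_cact e)^~ z : x y / x + y}.
Proof.
move=> x y; have [m [w ->]] := fracW z.
rewrite !loc_cactE cactDl; symmetry; exact: fracDr.
Qed.
Lemma loc_cactDr e x : {morph @loc_cact e x : m n / m + n}.
Proof.
move=> z z'; have [m [w ->]] := fracW z; have [n [v ->]] := fracW z'.
have -> : (frac m w : locR) + (frac n v : locR) =
  frac (dval v *: m + dval w *: n) (denM w v) by exact: fracD.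
rewrite !loc_cactE.
have -> : forall b c, (frac b w : locR) + (frac c v : locR) =
  frac (dval v *: b + dval w *: c) (denM w v) by move=> *; exact: fracD.
congr frac; rewrite !cact_frob -cactDr; congr (cact a x _).
rewrite scalerDr !scalerA dvalM.
rewrite -[in dval v ^+ (p ^ e)](prednK (q_gt0 e)).
rewrite -[in dval w ^+ (p ^ e)](prednK (q_gt0 e)).
by rewrite !exprS !exprMn; congr (_ *: _ + _ *: _); ring.
Qed.
Lemma loc_cactM e e' n (h : (e + e')%N = n) x y z :
  loc_cact (cmul C h x y) z = loc_cact x (loc_cact y z).
Proof.
have [m [w ->]] := fracW z; rewrite !loc_cactE cactM cact_frob scalerA.
congr (frac (cact a x (cact a y (_ *: _))) w).
rewrite -exprM -exprD -h expnD; congr (_ ^+ _).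
have := q_gt0 e; have := q_gt0 e'; case: (p ^ e)%N => // k; case: (p ^ e')%N => // l.
by move=> _ _ /=; rewrite mulnS addnC [(k * _)%N]mulnC; lia.
Qed.
Lemma loc_cactZ r z : loc_cact (cstr C r) z = r *: z.
Proof.
have [m [w ->]] := fracW z; rewrite loc_cactE cactZ expn0 expr0 scale1r.
rewrite rscalE; symmetry; rewrite /lring_in /=.
have := fracZ r (den1 W) m w => /= ->; apply/frac_eq.
by exists 1; [exact: mset1 | rewrite dvalE !mul1r].
Qed.

Definition loc_action : cartier_action locR :=
  CartierAction loc_cactDl loc_cactDr loc_cactM loc_cactZ.
End Localize.

(* The action of a product of homogeneous elements of positive degree.  The
   n-th power of C_+ is additively generated by such products of n elements. *)
Definition cact_seq (M : lmodType R) (a : cartier_action M)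
  (xs : seq {e : nat & C e.+1}) (m : M) : M :=
  foldr (fun x m' => cact a (projT2 x) m') m xs.

(* The map M0 -> N0 induced by g is a nil-isomorphism: its kernel and its
   cokernel are annihilated by a power of C_+. *)
Definition nil_iso (M N : lmodType R) (a : cartier_action M)
  (b : cartier_action N) (M0 : M -> Prop) (N0 : N -> Prop) (g : M -> N) :=
  (exists n, forall xs, size xs = n -> forall m, M0 m -> g m = 0 ->
     cact_seq a xs m = 0) /\
  (exists n, forall xs, size xs = n -> forall z, N0 z ->
     exists2 m, M0 m & cact_seq b xs z = g m).

(* H^0_x of the localization M_x. *)
Definition power_torsion (M : lmodType R) (x : spec R)
  (z : locR M (cpl x)) : Prop :=
  exists n, forall s : seq R, size s = n -> (forall c, c \in s -> x c) ->
    (\prod_(c <- s) c) *: z = 0.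

Definition Ass (M : lmodType R) (x : spec R) : Prop :=
  exists m : M, forall r, x r <-> r *: m = 0.

Section TestModule.
Variables (M : lmodType R) (a : cartier_action M).

(* H^0_x(N_x) -> H^0_x(M_x) is a nil-isomorphism for all x in Ass M. *)
Definition test_condition (N : cartier_submod a) : Prop :=
  forall x : spec R, Ass M x ->
    nil_iso (loc_action (sub_action N) (cpl x)) (loc_action a (cpl x))
      (@power_torsion (mod_of N) x) (@power_torsion M x)
      (@loc_map R (cpl x) (mod_of N) M val).

(* N = tau(M, C). *)
Definition is_test_module (N : cartier_submod a) : Prop :=
  test_condition N /\
  forall N' : cartier_submod a, test_condition N' -> forall m, N m -> N' m.
End TestModule.
End CartierModules.
Arguments cact {p R FpR C M} a {e} x m : rename.

Section Transpose.
Variables (p : nat) (R S : comPzRingType) (f : {rmorphism R -> S}).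
Variables (FpR : Fp_algebra p R) (FpS : Fp_algebra p S).
Variable T : mod_of (omega f).
Variables (I : submod (Kmod R)) (U : spec R -> Prop).

(* With I = I_D: R(D), and S(f^* D) for f^* D computed on the open set U. *)
Definition RD : submod (Kmod R) := colon I.
Definition SD : submod (Lmod f) := colon (pull_div f I U).

Let T_D s t : val T (s + t) = val T s + val T t.
Proof. by have := mod_ofP T 1 s t; rewrite !scale1r. Qed.
Let T_Z r (s : S) : val T (f r * s) = r * val T s.
Proof.
have T0 : val T 0 = 0 by apply: (@addIr _ (val T 0)); rewrite -T_D !add0r.
by have := mod_ofP T r s 0; rewrite T0 !addr0.
Qed.
Let T_lin : linear (val T : rscal f S^o -> rscal idfun R^o).
Proof. by move=> r x y; rewrite T_D rscal_regE T_Z. Qed.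

Lemma TKE s w : TK T (afrac s w) = afrac (val T s) w.
Proof. exact: (@loc_mapE R (nzd R) (rscal f S^o) (rscal idfun R^o)). Qed.

Lemma KtoLE r w : KtoL f (afrac r w) = afrac (f r) w.
Proof.
apply: (@loc_mapE R (nzd R) (rscal idfun R^o) (rscal f S^o)) => a x y.
by rewrite rmorphD rmorphM.
Qed.

Lemma TKD : {morph TK T : x y / x + y}.
Proof.
move=> x y; have [s [w ->]] := lalgW x; have [t [v ->]] := lalgW y.
by rewrite afracDE !TKE afracDE T_D !T_Z.
Qed.

Lemma TKM a x : TK T (KtoL f a * x) = a * TK T x.
Proof.
have [s [w ->]] := lalgW x; have [r [v ->]] := lalgW a.
by rewrite KtoLE afracM !TKE afracM T_Z.
Qed.

Lemma TK_inL s : TK T (inL f s) = inK R (val T s).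
Proof. exact: TKE. Qed.

Lemma inL_f r : inL f (f r) = KtoL f (inK R r).
Proof. by rewrite KtoLE. Qed.

(* Only to keep unification from unfolding the localizations in what follows. *)
Opaque Ktot Ltot inK inL KtoL TK.

Lemma TK_SD (x : mod_of SD) (s : S) : RD (TK T (val x * inL f s)).
Proof.
move=> a Ia; have [|b eb] := mod_ofP x (KtoL f a).
  move=> Q _; exists 1; first exact: spec_proper.
  by rewrite rmorph1 mul1r; exact: ext_in.
exists (val T (b * s)); rewrite -TK_inL rmorphM -eb mulrC -TKM.
by congr (TK T _); rewrite mulrCA mulrA.
Qed.

Lemma varsigma_linear (x : mod_of SD) :
  hom (rscal f S^o) (mod_of RD) (fun s => to_mod (TK_SD x s)).
Proof.
move=> r s t; apply: val_inj.
have -> : val (r *: to_mod (TK_SD x s) + to_mod (TK_SD x t)) =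
  inK R r * TK T (val x * inL f s) + TK T (val x * inL f t) :> Ktot R by [].
rewrite to_modK -TKM -TKD; congr (TK T _).
have -> : r *: s + t = f r * s + t :> S by [].
by rewrite rmorphD rmorphM mulrDr -inL_f mulrCA.
Qed.

(* x |-> (s |-> T_K (x s)). *)
Definition varsigma (x : mod_of SD) : mod_of (hom (rscal f S^o) (mod_of RD)) :=
  to_mod (varsigma_linear x).

Definition shriek e (phi : mod_of RD -> mod_of RD) (mu : S -> mod_of RD) :
  S -> mod_of RD := fun s => phi (mu (s ^+ (p ^ e))).

(* psi is an element of Hom_S(F^e_* M, M). *)
Definition frob_hom e (M : lmodType S) (psi : M -> M) : Prop :=
  {morph psi : x y / x + y} /\
  forall s x, psi (s ^+ (p ^ e) *: x) = s *: psi x.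

Definition is_transpose e (phi : mod_of RD -> mod_of RD)
  (psi : mod_of SD -> mod_of SD) : Prop :=
  frob_hom e psi /\
  forall x s, val (varsigma (psi x)) s = shriek e phi (val (varsigma x)) s.

Definition transposable (C : cartier_algebra FpR)
  (a : cartier_action C (mod_of RD)) : Prop :=
  forall e (k : C e), exists psi, is_transpose e (cact a k) psi.

Let SD_valD (x y : mod_of SD) : val (x + y) = (val x : Ltot f) + val y :> Ltot f.
Proof. exact: rsub_valD. Qed.
Let RD_valD (x y : mod_of RD) : val (x + y) = (val x : Ktot R) + val y :> Ktot R.
Proof. exact: rsub_valD. Qed.
Let SD_valZ s (x : mod_of SD) : val (s *: x) = inL f s * val x :> Ltot f.
Proof. exact: rsub_valZ. Qed.

Let SD_TKD (x y : mod_of SD) s : TK T (val (x + y) * inL f s) =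
  TK T (val x * inL f s) + TK T (val y * inL f s).
Proof. by rewrite SD_valD mulrDl TKD. Qed.
Let SD_TKZ r (x : mod_of SD) s : TK T (val (f r *: x) * inL f s) =
  inK R r * TK T (val x * inL f s).
Proof. by rewrite SD_valZ inL_f -mulrA TKM. Qed.

Section Action.
Hypothesis T_gen : generically_iso T.

Lemma varsigmaE x s : val (val (varsigma x) s) = TK T (val x * inL f s).
Proof. by []. Qed.

Lemma varsigma_inj : injective varsigma.
Proof.
move=> x y e; apply: val_inj.
have {}e s : TK T ((val x - val y) * inL f s) = 0.
  have exy : TK T (val x * inL f s) = TK T (val y * inL f s).
    by rewrite -!varsigmaE e.
  apply: (@addIr _ (TK T (val y * inL f s))).
  by rewrite -TKD -mulrDl subrK exy add0r.
apply/eqP; rewrite -subr_eq0; apply/eqP.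
move: (val x - val y : Ltot f) e => z; have [s [w ->]] := lalgW z => e.
Transparent Ktot Ltot inK inL KtoL TK.
have Ts t : val T (s * t) = 0.
  have /afrac_eq[u Wu] : afrac (val T (s * t)) (denM w (den1 _)) =
      afrac 0 (den1 _) :> Ktot R.
    transitivity (0 : Ktot R); last by symmetry; exact: frac0.
    by have := e t; rewrite afracM TKE.
  rewrite mulr0 => /= eu; apply: (_ : nzd R (u * dval (den1 (nzd R)))) => //.
  exact: msetM (denP _).
have h0 : @loc_map R (nzd R) _ _ (twist T) (afrac s w) =
          @loc_map R (nzd R) _ _ (twist T) 0.
  have tlin : linear (twist T).
    move=> r x' y'; apply: val_inj; apply/funext => t.
    have -> : val (r *: twist T x' + twist T y') t =
      r * val T (x' * t) + val T (y' * t) by [].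
    rewrite -T_Z -T_D; congr (val T _).
    have -> : r *: x' + y' = f r * x' + y' :> S by [].
    by rewrite mulrDl mulrA.
  rewrite -[in RHS](frac0 _ (den1 _)) !loc_mapE //.
  have -> : twist T s = 0 by apply: val_inj; apply/funext => t; exact: Ts.
  have -> : twist T 0 = 0.
    by apply: val_inj; apply/funext => t; have := Ts 0; rewrite mulr0 /= mul0r.
  by rewrite !frac0.
exact: bij_inj T_gen _ _ h0.
Qed.

Opaque Ktot Ltot inK inL KtoL TK.

Lemma transpose_unique e phi (psi psi' : mod_of SD -> mod_of SD) :
  is_transpose e phi psi ->
  (forall x s, val (varsigma (psi' x)) s = shriek e phi (val (varsigma x)) s) ->
  psi =1 psi'.
Proof.
move=> [_ h] h' x; apply: varsigma_inj; apply: val_inj; apply/funext => s.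
by rewrite h h'.
Qed.

Variables (C : cartier_algebra FpR) (a : cartier_action C (mod_of RD)).
Hypothesis a_tr : transposable a.

(* The transpose exists by transposability and is unique by
   [transpose_unique]. *)
Definition transpose e (k : C e) : mod_of SD -> mod_of SD :=
  projT1 (cid (a_tr k)).

Lemma transposeP e (k : C e) : is_transpose e (cact a k) (transpose k).
Proof. exact: projT2 (cid (a_tr k)). Qed.

Let trE e (k : C e) x s : TK T (val (transpose k x) * inL f s) =
  val (cact a k (val (varsigma x) (s ^+ (p ^ e)))).
Proof. by rewrite -varsigmaE (transposeP k).2. Qed.

Let trU e (k : C e) psi :
  (forall x s, TK T (val (psi x) * inL f s) =
     val (cact a k (val (varsigma x) (s ^+ (p ^ e))))) -> transpose k =1 psi.
Proof.
move=> h; apply: (transpose_unique (transposeP k)) => x s.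
by apply: val_inj; rewrite varsigmaE h.
Qed.

Let pb := pullback_algebra f FpS C.

Definition pb_act_bil e (x : mod_of SD) (k : C e) (s : S) : mod_of SD :=
  transpose k (s *: x).

Lemma pb_act_bal e x :
  balanced (@pb_ract _ _ _ C e) (@pb_lact _ _ f) (@pb_act_bil e x).
Proof.
split=> [s k k'|k s s'|k r s]; rewrite /pb_act_bil.
- apply: (trU (psi := fun y => transpose k y + transpose k' y)) => y t.
  rewrite cactDl; apply: etrans (SD_TKD _ _ _) _.
  apply: etrans (congr2 +%R (trE k _ _) (trE k' _ _)) _.
  exact: esym (RD_valD _ _).
- by rewrite scalerDl (transposeP k).1.1.
- have -> : pb_lact f r s *: x = f r *: (s *: x) by rewrite scalerA.
  apply: (trU (psi := fun y => transpose k (f r *: y))) => y t.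
  rewrite trE /pb_ract cactM cactZ; congr (val (cact a k _)).
  apply: val_inj; rewrite varsigmaE.
  apply: etrans (SD_TKZ _ _ _) _; symmetry; exact: rsub_valZ.
Qed.

(* f^* C acts on S(f^* D): k (x) s sends x to k^T (s x), see [pb_cactE]. *)
Definition pb_cact e (u : pb e) (x : mod_of SD) : mod_of SD :=
  tlift (pb_act_bil x) u.

Lemma pb_cactE e (k : C e) s x :
  pb_cact (ptens f k s) x = transpose k (s *: x).
Proof. exact: (tliftE _ _ (pb_act_bal _ x)). Qed.

Lemma pb_cactDl e x : {morph (@pb_cact e)^~ x : u v / u + v}.
Proof. exact: (tliftD (pb_act_bal _ x)). Qed.
Lemma pb_cactDr e u : {morph @pb_cact e u : x y / x + y}.
Proof.
move=> x y; move: u; apply: tensor_ext => [|u v|k s]; first exact: pb_cactDl.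
  by rewrite !pb_cactDl addrACA.
by rewrite !pb_cactE scalerDr (transposeP k).1.1.
Qed.
Lemma pb_cactM e e' n (h : (e + e')%N = n) u v x :
  pb_cact (cmul pb h u v) x = pb_cact u (pb_cact v x).
Proof.
move: u; apply: tensor_ext => [u u'|u u'|k s]; try exact: pb_cactDl.
  by rewrite -pb_cactDl -cmulDl.
move: v; apply: tensor_ext => [v v'|v v'|k' t].
- by rewrite cmulDr pb_cactDl.
- by rewrite pb_cactDl pb_cactDr.
have -> : cmul pb h (tens _ _ k s) (tens _ _ k' t) =
  ptens f (cmul C h k k') (s ^+ (p ^ e') * t) by exact: pb_mulE.
rewrite !pb_cactE -(transposeP k').1.2 scalerA.
apply: (trU (psi := fun y => transpose k (transpose k' y))) => y r.
transitivity (val (cact a k (cact a k' (val (varsigma y) (r ^+ (p ^ n)))))).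
  apply: etrans (trE k _ _) _; congr (val (cact a k _)); apply: val_inj.
  by apply: etrans (trE k' _ _) _; rewrite -exprM -expnD h.
by rewrite (cactM a h).
Qed.
Lemma pb_cactZ s x : pb_cact (cstr pb s) x = s *: x.
Proof.
rewrite pb_cactE; apply: (trU (psi := id)) => y t.
rewrite (cactZ a) expn0 expr1; apply: etrans (esym (varsigmaE _ _)) _.
by congr val; rewrite scale1r.
Qed.

Definition pullback_action : cartier_action pb (mod_of SD) :=
  CartierAction pb_cactDl pb_cactDr pb_cactM pb_cactZ.
End Action.
End Transpose.
Transparent Ktot Ltot inK inL KtoL TK.

(* Main.v *)
(* M = R(D) and P = S(f^* D) are generically free of rank 1 over R and S, and by
   S_1 the associated primes of R and S are minimal.  Hence the test condition
   on a Cartier submodule N of M says that c C_+^n M is contained in N for some n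
   and some non-zero-divisor c, and likewise over S.

   The transposition formula T_K(k^T(x) s) = k(T_K(x s^q)) makes both the image
   under T_K of a Cartier submodule of P and { x in P | T_K(x S) in N } Cartier
   submodules.  The second one inherits the test condition from N, which gives
   one inclusion by minimality.  For the other one, ker f is nilpotent because f
   is dominant, so the elements of C of high degree map M to the part of M killed
   by ker f.  By self-injectivity of K (Gorenstein in codimension 0) and the
   generic isomorphism of S with Hom_R(S, R), that part generically equals
   T_K(P).

   That P is generically all of L is where S_2 enters: a section of f^* D over
   the inverse image of U lies, up to a fixed denominator, in the S-module
   { x in L | T_K(x S) in R } = Hom_R(S, R), because the associated primes of
   K/R have height at most 1. *)

Require Import Defs.
From HB Require Import structures.
From mathcomp Require Import all_boot all_algebra.
From mathcomp Require Import boolp classical_sets functions.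
From mathcomp Require Import ring.

Set Implicit Arguments.
Unset Strict Implicit.
Unset Printing Implicit Defensive.

Import GRing.Theory.
Local Open Scope classical_set_scope.
Local Open Scope ring_scope.

(** * Submodules, linear maps and finite generation *)

Section Submodules.
Variables (A : pzRingType) (V : lmodType A) (N : submod V).

Lemma submodD x y : N x -> N y -> N (x + y).
Proof. by move=> Nx Ny; have := submod_lin 1 Nx Ny; rewrite scale1r. Qed.

Lemma submodZ a x : N x -> N (a *: x).
Proof. by move=> Nx; have := submod_lin a Nx (submod0 N); rewrite addr0. Qed.

Lemma submodN x : N x -> N (- x).
Proof. by rewrite -scaleN1r; exact: submodZ. Qed.

Lemma submodB x y : N x -> N y -> N (x - y).
Proof. by move=> Nx Ny; apply: submodD => //; exact: submodN. Qed.

Lemma submod_sum (I : Type) (s : seq I) (P : pred I) (F : I -> V) :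
  (forall i, P i -> N (F i)) -> N (\sum_(i <- s | P i) F i).
Proof.
by move=> NF; elim/big_rec: _ => [|i x Pi Nx]; [exact: submod0 | apply: submodD; auto].
Qed.

End Submodules.

Lemma idealM (A : comPzRingType) (I : submod (A^o : lmodType A)) (a b : A) :
  I b -> I (a * b).
Proof. exact: (submodZ (N := I) a). Qed.

Section LinearMaps.
Variables (A : pzRingType) (V W : lmodType A) (g : V -> W) (lg : linear g).

Lemma lin0 : g 0 = 0.
Proof.
have := lg (-1) 0 0; rewrite scaler0 addr0 => /eqP.
by rewrite scaleN1r addrC subrr => /eqP.
Qed.
Lemma linD x y : g (x + y) = g x + g y.
Proof. by have := lg 1 x y; rewrite !scale1r. Qed.
Lemma linZ a x : g (a *: x) = a *: g x.
Proof. by have := lg a x 0; rewrite !addr0 lin0 addr0. Qed.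
Lemma linB x y : g (x - y) = g x - g y.
Proof. by rewrite -!scaleN1r linD linZ. Qed.
Lemma lin_sum (I : Type) (s : seq I) (P : pred I) (F : I -> V) :
  g (\sum_(i <- s | P i) F i) = \sum_(i <- s | P i) g (F i).
Proof. by elim/big_rec2: _ => [|i x y _ <-]; [exact: lin0 | exact: linD]. Qed.

End LinearMaps.

Section ColonIdeal.
Variables (A : comPzRingType) (V : lmodType A) (N : submod V) (v : V).

Let ann_set (a : (A^o : lmodType A)) : Prop := N ((a : A) *: v).
Let ann0 : ann_set 0. Proof. by rewrite /ann_set scale0r; exact: submod0. Qed.
Let ann_lin (a : A) x y : ann_set x -> ann_set y -> ann_set (a *: x + y).
Proof.
by move=> Nx Ny; rewrite /ann_set scalerDl -scalerA; exact: submod_lin.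
Qed.
Definition ann_mod : submod (A^o : lmodType A) := Submod ann0 ann_lin.
End ColonIdeal.

(* Directed, rather than chain, unions: this form serves Zorn's lemma and
   increasing sequences alike. *)
Section DirectedUnion.
Variables (A : pzRingType) (V : lmodType A) (X : Type) (F : X -> submod V) (x0 : X).
Hypothesis dir : forall x y, exists z, (forall v, F x v -> F z v) /\
  (forall v, F y v -> F z v).
Let un (v : V) : Prop := exists x, F x v.
Let un0 : un 0. Proof. by exists x0; exact: submod0. Qed.
Let un_lin (a : A) x y : un x -> un y -> un (a *: x + y).
Proof.
move=> [i Fi] [j Fj]; have [k [ik jk]] := dir i j.
by exists k; apply: submod_lin; auto.
Qed.
Definition dirU : submod V := Submod un0 un_lin.
End DirectedUnion.

Definition fg_sub (A : pzRingType) (V : lmodType A) (N : submod V) : Prop :=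
  exists (n : nat) (g : 'I_n -> V), (forall i, N (g i)) /\
    forall x, N x -> exists c : 'I_n -> A, x = \sum_i c i *: g i.

Lemma fg_subP (A : pzRingType) (V : lmodType A) (N : submod V) :
  fg (mod_of N) -> fg_sub N.
Proof.
move=> [n [g gP]]; exists n, (fun i => val (g i)); split=> [i|x Nx].
  exact: mod_ofP.
have [c e] := gP (to_mod Nx); exists c; rewrite -[LHS](to_modK Nx) e.
have vl : linear (val : mod_of N -> V) by move=> a y z; exact: linearP.
by rewrite (lin_sum vl); apply: eq_bigr => i _; rewrite (linZ vl).
Qed.

(** By directedness the finitely many generators lie in one member of the family. This serves as the
    ascending chain condition below. *)
Lemma fg_dirU (A : pzRingType) (V : lmodType A) (X : Type) (F : X -> submod V) x0
    (dir : forall x y, exists z, (forall v, F x v -> F z v) /\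
      (forall v, F y v -> F z v)) :
  fg_sub (dirU x0 dir) -> exists x, forall v, dirU x0 dir v -> F x v.
Proof.
move=> [n [g [gU gP]]].
have [x Fx] : exists x, forall i, F x (g i).
  have {gP} h : forall s : seq 'I_n, exists x, forall i, i \in s -> F x (g i).
    elim=> [|i s [x Fx]]; first by exists x0.
    have [y Fy] := gU i; have [z [xz yz]] := dir x y.
    exists z => j; rewrite inE => /predU1P[->|/Fx]; auto.
  by have [x Fx] := h (enum 'I_n); exists x => i; apply: Fx; rewrite mem_enum.
exists x => v /gP[c ->]; apply: submod_sum => i _; exact: submodZ.
Qed.

(** * Associated primes of noetherian rings *)

Section Noetherian.
Variables (R : comPzRingType) (noethR : noetherian R).
Notation ideal := (submod (R^o : lmodType R)).

(** Zorn's lemma: the union of a nonempty chain is finitely generated, hence contained in a member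
    of the chain. *)
Lemma noeth_max (F : ideal -> Prop) : (exists I, F I) ->
  exists2 I, F I & forall J, F J -> (forall a, I a -> J a) -> forall a, J a -> I a.
Proof.
move=> [I0 F0].
pose X := {I : ideal | F I}.
pose r : rel X := fun I J => `[< forall a, proj1_sig I a -> proj1_sig J a >].
have [|I J K /asboolP h /asboolP h'|B Btot|[I FI] Imax] :=
  @ZL_preorder X (exist _ I0 F0) r.
- by move=> I; apply/asboolP.
- by apply/asboolP; auto.
- case: (pselect (exists I, B I)) => [[I1 B1]|B0]; last first.
    by exists (exist _ I0 F0) => I BI; case: B0; exists I.
  pose G (i : {I : X | B I}) : ideal := proj1_sig (proj1_sig i).
  have dir : forall x y, exists z, (forall v, G x v -> G z v) /\
    (forall v, G y v -> G z v).
    move=> [I BI] [J BJ]; have [/asboolP h|/asboolP h] := Btot _ _ BI BJ.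
      by exists (exist _ J BJ).
    by exists (exist _ I BI).
  have [[J BJ] GJ] :=
    fg_dirU (fg_subP (noethR (dirU (exist _ I1 B1) dir))).
  exists J => I BI; apply/asboolP => a Ia; apply: GJ.
  by exists (exist _ I BI).
- exists I => // J FJ IJ a Ja.
  by have /asboolP := Imax (exist _ J FJ) (asboolT IJ); apply.
Qed.

(** An associated prime of V / N, found on the multiples of v: an annihilator maximal among those of
    elements [b *: v] outside [N] is prime. *)
Lemma ass_exists (V : lmodType R) (N : submod V) (v : V) : ~ N v ->
  exists (b : R) (x : spec R), forall c, x c <-> N (c *: (b *: v)).
Proof.
move=> Nv.
pose F (I : ideal) := exists2 b : R, ~ N (b *: v) & I = ann_mod N (b *: v).
have [|I [b Nb Ib] Imax] := @noeth_max F.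
  by exists (ann_mod N (1 *: v)), 1; rewrite ?scale1r.
have I1 : ~ I 1 by rewrite Ib /= scale1r.
have Ipr (c d : R) : I (c * d) -> I c \/ I d.
  move=> Icd; case: (pselect (I d)) => [|Id]; [by right | left].
  apply: (Imax (ann_mod N (d *: (b *: v)))).
  - exists (d * b); last by rewrite scalerA.
    by rewrite -scalerA => Nd; apply: Id; rewrite Ib.
  - move=> a; rewrite Ib /= => Na.
    by rewrite scalerA mulrC -scalerA; exact: submodZ.
  - by move: Icd; rewrite Ib /= -scalerA.
by exists b, (Spec I1 Ipr) => c; rewrite /= Ib.
Qed.

Lemma fg_ideal (I : ideal) : fg_sub I.
Proof. exact: fg_subP (noethR I). Qed.

(** The coordinates [e i] with i < n embed [N] in R^n. By induction on n, [N] is an extension of its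
    image under the last coordinate, an ideal, by the kernel. *)
Lemma fg_separated (V : lmodType R) (e : nat -> V -> R)
    (le : forall i, linear (e i : V -> R^o)) n (N : submod V) :
  (forall v, N v -> (forall i, (i < n)%N -> e i v = 0) -> v = 0) -> fg_sub N.
Proof.
elim: n N => [|n IH] N sep.
  exists 0%N, (fun=> 0); split=> [[]//|x Nx].
  by exists (fun=> 0); rewrite big_ord0; exact: sep.
pose K (v : V) : Prop := N v /\ e n v = 0.
have K0 : K 0 by split; [exact: submod0 | exact: (lin0 (le n))].
have Kl a x y : K x -> K y -> K (a *: x + y).
  move=> [Nx ex] [Ny ey]; split; first exact: submod_lin.
  by rewrite [LHS](le n) ey ex scaler0 addr0.
have [|k [g [Kg gP]]] := IH (Submod K0 Kl).
  move=> v [Nv env] h; apply: sep => // i; rewrite ltnS leq_eqVlt.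
  by move=> /orP[/eqP->//|]; exact: h.
pose E (r : (R^o : lmodType R)) : Prop := exists2 v, N v & e n v = r.
have E0 : E 0 by exists 0; [exact: submod0 | exact: (lin0 (le n))].
have El (a : R) x y : E x -> E y -> E (a *: x + y).
  move=> [u Nu <-] [v Nv <-]; exists (a *: u + v); first exact: submod_lin.
  exact: le.
have [l [h [Eh hP]]] := fg_ideal (Submod E0 El).
pose w i := projT1 (cid2 (Eh i)).
have Nw i : N (w i) by rewrite /w; case: cid2.
have ew i : e n (w i) = h i by rewrite /w; case: cid2.
exists (l + k)%N, (fun i => match fintype.split i with inl j => w j | inr j => g j end).
split=> [i|x Nx]; first by case: (fintype.split i) => j //; case: (Kg j).
have [|c ec] := hP (e n x); first by exists x.
have [|d ed] := gP (x - \sum_i c i *: w i).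
  split; first by apply: submodB => //; apply: submod_sum => i _; exact: submodZ.
  rewrite (linB (le n)) (lin_sum (le n)) ec; apply/eqP; rewrite subr_eq0; apply/eqP.
  by apply: eq_bigr => i _; rewrite (linZ (le n)) ew.
exists (fun i => match fintype.split i with inl j => c j | inr j => d j end).
rewrite big_split_ord /=; apply/eqP; rewrite -subr_eq addrC.
have -> : \sum_(i < l) match fintype.split (lshift k i) with inl j => c j | inr j => d j end
  *: match fintype.split (lshift k i) with inl j => w j | inr j => g j end =
  \sum_i c i *: w i.
  apply: eq_bigr => i _.
  by case: split_ordP => j /eqP; rewrite ?eq_shift // => /eqP->.
have E1 : \sum_(i < k) match fintype.split (rshift l i) with inl j => c j | inr j => d j end
  *: match fintype.split (rshift l i) with inl j => w j | inr j => g j end =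
  \sum_i d i *: g i.
  apply: eq_bigr => i _.
  by case: split_ordP => j /eqP; rewrite ?eq_shift // => /eqP->.
by rewrite E1 addrC -ed opprB addrC subrK.
Qed.

End Noetherian.

(** The product of multipliers for the generators of [H] works for all of [H]; this turns pointwise
    denominators into a single one. *)
Lemma uniform_den (R : comPzRingType) (V : lmodType R) (H N : submod V) (W : mset R) :
  fg_sub H -> (forall h, H h -> exists2 w, W w & N (w *: h)) ->
  exists2 w, W w & forall h, H h -> N (w *: h).
Proof.
move=> [n [g [Hg gP]]] den.
have {gP} gen w : (forall i, N (w *: g i)) -> forall h, H h -> N (w *: h).
  move=> Ng h /gP[c ->]; rewrite scaler_sumr; apply: submod_sum => i _.
  by rewrite scalerA mulrC -scalerA; exact: submodZ.
have [w Ww wP] : exists2 w, W w & forall i, i \in enum 'I_n -> N (w *: g i).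
  elim: (enum 'I_n) => [|i s [w Ww IH]]; first by exists 1 => //; exact: mset1.
  have [u Wu Nu] := den _ (Hg i); exists (u * w); first exact: msetM.
  move=> j; rewrite inE => /predU1P[->|/IH h].
    by rewrite mulrC -scalerA; exact: submodZ.
  by rewrite -scalerA; exact: submodZ.
by exists w => //; apply: gen => i; apply: wP; rewrite mem_enum.
Qed.

(** * Local rings at primes of depth at most one *)

Section LocalRing.
Variables (R : comPzRingType) (x : spec R).
Notation Rx := (lring (cpl x)).
Notation frR := (@afrac R (cpl x) R idfun).

Lemma cpl_den (w : den (cpl x)) : ~ x (dval w).
Proof. exact: (denP w). Qed.

Lemma lring_eq (r s : R) w v : frR r w = frR s v <->
  exists2 u, ~ x u & u * dval v * r = u * dval w * s.
Proof. exact: afrac_eq. Qed.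

Section Prime.
Variables (y : spec R) (yx : forall a, y a -> x a).

Let lp_set (z : (Rx^o : lmodType Rx)) : Prop := exists r w, z = frR r w /\ y r.
Let lpE r w : lp_set (frR r w) <-> y r.
Proof.
split=> [[s [v [/lring_eq[u xu e] ys]]]|]; last by exists r, w.
have /spec_prime[/spec_prime[/yx//|/yx]|//] : y (u * dval v * r).
- by rewrite e; exact: (submodZ (N := y)).
- by move/cpl_den.
Qed.
Let lp0 : lp_set 0.
Proof. by exists 0, (den1 _); split; [exact: esym (frac0 _ _) | exact: submod0]. Qed.
Let lp_lin (a : Rx) z t : lp_set z -> lp_set t -> lp_set (a *: z + t).
Proof.
have [b [u ->]] := lalgW a.
move=> [r [w [-> yr]]] [s [v [-> ys]]].
have -> : frR b u *: (frR r w : Rx^o) + frR s v =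
  frR (dval v * (b * r) + dval (denM u w) * s) (denM (denM u w) v).
  have -> : frR b u *: (frR r w : Rx^o) = frR (b * r) (denM u w) by exact: afracM.
  exact: afracDE.
by apply/lpE; apply: submodD; apply: (submodZ (N := y)) => //;
  exact: (submodZ (N := y)).
Qed.
Let lp1 : ~ Submod lp0 lp_lin 1.
Proof. by move/(lpE 1 (den1 _)); exact: spec_proper. Qed.
Let lp_pr (a b : Rx) : Submod lp0 lp_lin (a * b) ->
  Submod lp0 lp_lin a \/ Submod lp0 lp_lin b.
Proof.
have [r [w ->]] := lalgW a; have [s [v ->]] := lalgW b.
rewrite afracM => /lpE /spec_prime[]; [left|right]; exact/lpE.
Qed.
Definition loc_prime : spec Rx := Spec lp1 lp_pr.
Lemma loc_primeE r w : loc_prime (frR r w) <-> y r.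
Proof. exact: lpE. Qed.
End Prime.

Lemma dim0_minimal (y : spec R) : ~ krull_dim_ge Rx 1 ->
  (forall a, y a -> x a) -> forall a, x a -> y a.
Proof.
move=> d0 yx a xa; apply: contrapT => ya; apply: d0.
exists (fun i => if i is 0 then loc_prime yx else loc_prime (fun a xa => xa)).
case=> // _; split=> [z|].
  have [r [w ->]] := lalgW z; rewrite !loc_primeE; exact: yx.
by exists (frR a (den1 _)); rewrite loc_primeE.
Qed.

Lemma lring_nonunit r w : ~ (exists b, frR r w * b = 1) -> x r.
Proof.
move=> nu; apply: contrapT => xr; apply: nu.
pose v : den (cpl x) := mkden (xr : cpl x r); have vE : dval v = r by [].
exists (frR (dval w) v); rewrite afracM; apply/lring_eq.
by exists 1; [exact: spec_proper | rewrite !dvalE vE; ring].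
Qed.

Notation Mx := (loc (cpl x) (R^o : lmodType R)).
Notation frM := (@Defs.frac R (cpl x) (R^o : lmodType R)).

Lemma loc_reg_eq (r s : R) w v : frM r w = frM s v <->
  exists2 u, ~ x u & u * dval v * r = u * dval w * s.
Proof. exact: frac_eq. Qed.

Lemma loc_reg_eq0 (r : R) w : frM r w = 0 <-> exists2 u, ~ x u & u * r = 0.
Proof.
rewrite -(frac0 _ w); split=> [/loc_reg_eq|] [u xu e].
  exists (u * dval w); first by move=> /spec_prime[//|]; exact: cpl_den.
  by rewrite e mulr0.
by apply/loc_reg_eq; exists u => //; rewrite mulr0 mulrAC e mul0r.
Qed.

Lemma loc_reg_nonzero : ~ forall z : Mx, z = 0.
Proof.
move=> /(_ (frM 1 (den1 _))) /loc_reg_eq0[u xu].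
by rewrite mulr1 => u0; apply: xu; rewrite u0; exact: submod0.
Qed.

Lemma in_span0 (z : Mx) : in_span [::] z <-> z = 0.
Proof. by split=> [[m ->]|->]; [|exists (fun=> 0)]; rewrite big_ord0. Qed.

Lemma in_span1 (s : Rx) (z : Mx) : in_span [:: s] z <-> exists m, z = s *: m.
Proof.
split=> [[m ->]|[m ->]]; first by exists (m 0%N); rewrite big_ord1.
by exists (fun=> m); rewrite big_ord1.
Qed.

(** If dim R_x were positive, the maximal ideal of R_x would contain a regular element, although it
    kills a nonzero element of R_x. *)
Lemma ass_dim0 : serre_S 2 (R^o : lmodType R) -> Ass (R^o : lmodType R) x ->
  ~ krull_dim_ge Rx 1.
Proof.
move=> S2 [r rP] /(S2 x 1%N isT)[/loc_reg_nonzero//|[s [ss [nu [reg _]]]]].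
case: s ss nu reg => [//|s [//|? ?//]] _ nu.
move=> /(_ 0%N isT (frM r (den1 _))); rewrite take0 !in_span0.
have [b [w e]] := lalgW s.
have xb : x b by apply: (@lring_nonunit b w); rewrite -e; apply: nu; rewrite inE.
rewrite e => reg.
have /reg/loc_reg_eq0[u xu ur] : frR b w *: frM r (den1 _) = 0.
  rewrite fracZ; apply/loc_reg_eq0; exists 1; first exact: spec_proper.
  by rewrite mul1r; apply/rP.
by apply: xu; apply/rP.
Qed.

(* x is associated to R/wR, so R_x has depth 1. *)
Lemma ass_quotient_dim1 (w r : R) : serre_S 2 (R^o : lmodType R) -> nzd R w ->
  (forall c, x c <-> exists b, c * r = w * b) -> ~ krull_dim_ge Rx 2.
Proof.
move=> S2 wnz xP /(S2 x 2%N isT)[/loc_reg_nonzero//|[s [ss [nu [reg _]]]]].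
case: s ss nu reg => [//|s1 [//|s2 [|//]]] _ nu reg.
have [a1 [w1 e1]] := lalgW s1; have [a2 [w2 e2]] := lalgW s2.
have x1 : x a1 by apply: (@lring_nonunit a1 w1); rewrite -e1; apply: nu; rewrite !inE eqxx.
have x2 : x a2.
  by apply: (@lring_nonunit a2 w2); rewrite -e2; apply: nu; rewrite !inE eqxx orbT.
have /xP[b1 eb1] := x1; have /xP[b2 eb2] := x2.
have eab : a2 * b1 = a1 * b2.
  apply/eqP; rewrite -subr_eq0; apply/eqP; apply: wnz.
  have -> : w * (a2 * b1 - a1 * b2) = a2 * (w * b1) - a1 * (w * b2) by ring.
  by rewrite -eb1 -eb2; ring.
(* Since a2 b1 = a1 b2 lies in s1 R_x, regularity of [s2] modulo [s1] puts b1 in s1 R_x. *)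
have /= := reg 1%N isT (frM b1 (den1 _)); rewrite !in_span1 => [[|m]].
  exists (frM (dval w1 * b2) w2); rewrite e1 e2 !fracZ; apply/loc_reg_eq.
  exists 1; first exact: spec_proper.
  rewrite !dvalE mulr1 !mul1r.
  have -> : dval w1 * dval w2 * (a2 *: (b1 : R^o)) = dval w1 * dval w2 * (a2 * b1) by [].
  have -> : dval w2 * (a1 *: ((dval w1 * b2) : R^o)) = dval w2 * (a1 * (dval w1 * b2)) by [].
  by rewrite eab; ring.
have [c [v ->]] := fracW m; rewrite e1 fracZ => /loc_reg_eq[u xu].
have -> : a1 *: (c : R^o) = a1 * c by [].
rewrite !dvalE mulr1 => eb.
(* Inserting b1 = s1 (c / v) into a1 r = w b1 gives an element killed by [s1]. Its vanishing puts r
   in w R_x, so some element outside [x] kills r modulo w. *)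
have /= := reg 0%N isT (frM (u * dval w1 * dval v * r - w * u * c) (den1 _)).
rewrite !in_span0 => h; have /h/loc_reg_eq0[t xt] :
    s1 *: frM (u * dval w1 * dval v * r - w * u * c) (den1 _) = 0.
  rewrite e1 fracZ; apply/loc_reg_eq0; exists 1; first exact: spec_proper.
  rewrite mul1r.
  have -> : a1 *: ((u * dval w1 * dval v * r - w * u * c) : R^o) =
    u * dval w1 * dval v * (a1 * r) - w * (u * (a1 * c)).
    by transitivity (a1 * (u * dval w1 * dval v * r - w * u * c)) => //; ring.
  rewrite eb1; apply/eqP; rewrite subr_eq0; apply/eqP.
  by rewrite -eb; ring.
move=> /eqP; rewrite mulrBr subr_eq0 => /eqP e.
have : x (t * (u * dval w1 * dval v)).
  by apply/xP; exists (t * u * c); rewrite -mulrA e; ring.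
by move=> /spec_prime[//|/spec_prime[/spec_prime[//|]|]]; exact: cpl_den.
Qed.

End LocalRing.

(** * Zero-dimensional local rings and non-zero-divisors in ideals *)

Section AssociatedPrimes.
Variables (R : comPzRingType) (noethR : noetherian R).

Variables (x : spec R).

Let kills k (r : R^o) : Prop :=
  forall s : seq R, size s = k -> (forall c, c \in s -> x c) ->
    exists2 u, ~ x u & u * ((r : R) * \prod_(c <- s) c) = 0.
Let kills0 k : kills k 0.
Proof.
by move=> s _ _; exists 1; [exact: spec_proper | rewrite mul0r mulr0].
Qed.
Let kills_lin k (a : R) r t : kills k r -> kills k t -> kills k (a *: r + t).
Proof.
move=> kr kt s ss xs; have [u xu eu] := kr s ss xs; have [v xv ev] := kt s ss xs.
exists (u * v); first by move=> /spec_prime[].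
transitivity (a * v * (u * ((r : R) * \prod_(c <- s) c)) +
  u * (v * ((t : R) * \prod_(c <- s) c))).
  have -> : a *: r + t = a * (r : R) + (t : R) :> R by [].
  by ring.
by rewrite eu ev !mulr0 addr0.
Qed.
Let kill k : submod (R^o : lmodType R) := Submod (@kills0 k) (@kills_lin k).

Let killS k r : (forall c, x c -> kill k (c * r)) -> kill k.+1 r.
Proof.
move=> h [//|c s] [ss] xs; have [|d ds|u xu e] := h c _ s ss.
- by apply: xs; rewrite inE eqxx.
- by apply: xs; rewrite inE ds orbT.
by exists u => //; rewrite big_cons -e; ring.
Qed.

Let kill_mono k l r : (k <= l)%N -> kill k r -> kill l r.
Proof.
move=> /subnK <-; elim: (l - k)%N => [//|n IH] /IH {}IH; apply: killS => c _.
exact: (submodZ (N := kill _)).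
Qed.

Hypothesis dim0 : ~ krull_dim_ge (lring (cpl x)) 1.

(** Let [kill k] be the largest of these ideals. If it misses 1, an associated prime of R / [kill k]
    lies in [x], since elements outside [x] act injectively there, so it equals [x]. Then x b lies
    in [kill k], hence b in [kill k.+1], although b is not in [kill k]. *)
Lemma dim0_nilpotent : exists k, forall s : seq R, size s = k ->
  (forall c, c \in s -> x c) -> exists2 u, ~ x u & u * \prod_(c <- s) c = 0.
Proof.
have dir k l : exists m, (forall r, kill k r -> kill m r) /\
    (forall r, kill l r -> kill m r).
  by exists (maxn k l); split=> r; apply: kill_mono; rewrite ?leq_maxl ?leq_maxr.
have [k kP] := fg_dirU (fg_ideal noethR (dirU 0%N dir)).
exists k; suff k1 : kill k 1.
  by move=> s ss xs; have [u xu e] := k1 s ss xs; exists u; rewrite ?mul1r in e *.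
apply: contrapT => /(ass_exists noethR)[b [y yP]].
have {}yP c : y c <-> kill k (c * b).
  by rewrite yP; have -> : c *: (b *: (1 : R^o)) = c * b by rewrite -[c * b]mulr1 -mulrA.
have y1 : ~ kill k b.
  by move=> h; apply: (@spec_proper _ y); apply/yP; rewrite mul1r.
have yx c : y c -> x c.
  move=> yc; apply: contrapT => xc; apply: y1 => s ss xs.
  have /yP/(_ s ss xs)[u xu e] := yc.
  exists (u * c); first by move=> /spec_prime[].
  by rewrite -[RHS]e -!mulrA.
apply: y1; apply: kP; exists k.+1; apply: killS => c xc.
by apply/yP; exact: dim0_minimal yx _ xc.
Qed.

Lemma dim0_nil c : x c -> exists2 u, ~ x u & exists n, u * c ^+ n = 0.
Proof.
move=> xc; have [k kP] := dim0_nilpotent.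
have [|d|u xu e] := kP (nseq k c); first exact: size_nseq.
  by rewrite mem_nseq => /andP[_ /eqP->].
by exists u => //; exists k; rewrite -[RHS]e big_nseq -Monoid.iteropE.
Qed.

End AssociatedPrimes.

Section ZeroSubmodule.
Variables (A : pzRingType) (V : lmodType A).
Let z0 : (0 : V) = 0. Proof. by []. Qed.
Let zl (a : A) (x y : V) : x = 0 -> y = 0 -> a *: x + y = 0.
Proof. by move=> -> ->; rewrite scaler0 addr0. Qed.
Definition zero_mod : submod V := @Submod A V (fun x => x = 0) z0 zl.
End ZeroSubmodule.

Lemma nzdP (R : comPzRingType) (c : R) : nzd R c <-> forall b, c * b = 0 -> b = 0.
Proof. by []. Qed.

(* Prime avoidance, without the finiteness of the set of associated primes: if c
   is a zero divisor killing r b <> 0 with prime annihilator x, then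
   c ^+ n + d, for suitable d outside x annihilated by c ^+ n, is injective on
   more than c. *)
Lemma nzd_in_ideal (R : comPzRingType) (I : submod (R^o : lmodType R)) :
  noetherian R ->
  (forall x : spec R, Ass (R^o : lmodType R) x -> ~ krull_dim_ge (lring (cpl x)) 1) ->
  (forall x : spec R, Ass (R^o : lmodType R) x -> exists2 c, I c & ~ x c) ->
  exists2 c, I c & nzd R c.
Proof.
move=> noethR dim0 Ix.
pose F (J : submod (R^o : lmodType R)) :=
  exists2 c, I c & forall r : R, J r -> (c : R) * r = 0 -> r = 0.
have [|J [c Ic cJ] Jmax] := noeth_max noethR (F := F).
  by exists (zero_mod (R^o : lmodType R)), 0; [exact: submod0 | move=> r /= ->].
exists c => //; apply/nzdP => r cr; apply: contrapT => r0.
have [b [x xP]] := ass_exists noethR (r0 : ~ zero_mod (R^o : lmodType R) r).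
have {}xP d : x d <-> d * (b * r) = 0 by exact: xP.
have assx : Ass (R^o : lmodType R) x by exists (b * r).
have xc : x c by apply/xP; rewrite mulrCA cr mulr0.
have [u xu [n un]] := dim0_nil noethR (dim0 _ assx) xc.
have [e Ie xe] := Ix _ assx.
have cJn i m : J i -> (c : R) ^+ m * i = 0 -> i = 0.
  move=> Ji; elim: m => [|m IH]; first by rewrite expr0 mul1r.
  rewrite exprS -mulrA => h; apply: IH; apply: cJ => //.
  exact: (submodZ (N := J)).
pose J' (j : (R^o : lmodType R)) : Prop := exists i t, J i /\ (j : R) = i + t * (b * r).
have J'0 : J' 0 by exists 0, 0; split; [exact: submod0 | rewrite mul0r addr0].
have J'l (a : R) j k : J' j -> J' k -> J' (a *: j + k).
  move=> [i [t [Ji ->]]] [l [s [Jl ->]]]; exists (a * i + l), (a * t + s).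
  split; first exact: submod_lin.
  by transitivity (a * (i + t * (b * r)) + (l + s * (b * r))) => //; ring.
have br : J (b * r).
  apply: (Jmax (Submod J'0 J'l)).
  (* Multiplying by c^n kills the summand u e, and c kills [b * r], so a relation first forces i =
     0. What remains puts u e t in [x], whence t is in [x] and t b r = 0. *)
  - exists (c ^+ n.+1 + u * e).
      by rewrite exprSr; apply: submodD; exact: idealM.
    move=> j [i [t [Ji ->]]] h.
    have /cJn i0 : c ^+ (n + n.+1) * i = 0.
      transitivity (c ^+ n * ((c ^+ n.+1 + u * e) * (i + t * (b * r))) -
        (u * c ^+ n) * (e * (i + t * (b * r))) - c ^+ (n + n) * t * b * (c * r)).
        by rewrite !exprD exprS; ring.
      by rewrite h un cr mulr0 !mul0r mulr0 !subr0.
    move: h; rewrite i0 // !add0r => h.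
    have /spec_prime[/spec_prime[]//|/xP//] : x (u * e * t).
    apply/xP; rewrite -[RHS]h mulrDl exprS.
    transitivity (u * e * (t * (b * r)) + c ^+ n * t * b * 0); last first.
      by rewrite -[in LHS]cr; ring.
    by rewrite mulr0; ring.
  - by move=> i Ji; exists i, 0; rewrite mul0r addr0.
  - by exists 0, 1; rewrite mul1r add0r; split=> //; exact: submod0.
have br0 : b * r = 0 by apply: cJ => //; rewrite mulrCA cr mulr0.
by apply: (@spec_proper _ x); apply/xP; rewrite br0 mulr0.
Qed.

(** * Test conditions at the generic points *)

Section CartierSeq.
Variables (p : nat) (R : comPzRingType) (FpR : Fp_algebra p R).
Variables (C : cartier_algebra FpR) (M : lmodType R) (a : cartier_action C M).
Notation homs := (seq {e : nat & C e.+1}).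

Definition deg (xs : homs) : nat := \sum_(x <- xs) (projT1 x).+1.

Lemma size_deg xs : (size xs <= deg xs)%N.
Proof.
elim: xs => [|x xs IH] //=; rewrite /deg big_cons -/(deg xs) addSn ltnS.
exact: leq_trans IH (leq_addl _ _).
Qed.

Lemma cact0 e (x : C e) : cact a x 0 = 0.
Proof. by apply: (@addIr _ (cact a x 0)); rewrite -cactDr !add0r. Qed.

Lemma cact_seq0 xs : cact_seq a xs 0 = 0.
Proof. by elim: xs => //= x xs ->; rewrite cact0. Qed.

Lemma cact_seq_cat xs ys m : cact_seq a (xs ++ ys) m = cact_seq a xs (cact_seq a ys m).
Proof. exact: foldr_cat. Qed.

Lemma cact_seq_frob r xs m :
  r *: cact_seq a xs m = cact_seq a xs (r ^+ (p ^ deg xs) *: m).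
Proof.
elim: xs r m => [|x xs IH] r m /=; first by rewrite /deg big_nil expr1.
by rewrite cact_frob IH /deg big_cons expnD exprM.
Qed.

Lemma pexp_gt0 e : (0 < p ^ e)%N.
Proof. by rewrite expn_gt0 prime_gt0 //; case: FpR. Qed.

Variable W : mset R.

Lemma locR_scale r m (w : den W) :
  r *: (Defs.frac m w : locR M W) = Defs.frac (r *: m) w.
Proof.
rewrite rscalE /lring_in /=; have := fracZ r (den1 W) m w => /= ->.
apply/frac_eq; exists 1; first exact: mset1.
by rewrite dvalM dval1 !mul1r.
Qed.

Lemma cact_seq_frac xs m (w : den W) : exists m',
  cact_seq (loc_action a W) xs (Defs.frac m w) = Defs.frac (cact_seq a xs m') w.
Proof.
elim: xs => [|x xs [m' e]]; first by exists m.
exists (dval w ^+ (p ^ (projT1 x).+1).-1 ^+ (p ^ deg xs) *: m').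
by rewrite /= e [LHS]loc_cactE cact_seq_frob.
Qed.

Lemma cact_seq_frac1 xs m :
  cact_seq (loc_action a W) xs (Defs.frac m (den1 W)) =
  Defs.frac (cact_seq a xs m) (den1 W).
Proof.
elim: xs => //= x xs ->.
by rewrite [LHS]loc_cactE dval1 expr1n scale1r.
Qed.

End CartierSeq.

Section SubLocalization.
Variables (R : comPzRingType) (M : lmodType R) (N : submod M) (W : mset R).
Notation lval := (@loc_map R W (mod_of N) M val).

Lemma lvalE (m : mod_of N) w : lval (Defs.frac m w) = Defs.frac (val m) w.
Proof. by apply: loc_mapE => a x y; exact: linearP. Qed.

Lemma lval_eq0 z : lval z = 0 -> z = 0.
Proof.
have [m [w ->]] := fracW z; rewrite lvalE -!(frac0 _ w) => /frac_eq[u Wu e].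
apply/frac_eq; exists u => //; apply: val_inj.
by rewrite !(linearZ_LR (val : mod_of N -> M)) e (linear0 (val : mod_of N -> M)).
Qed.

Lemma lvalZ r (z : locR (mod_of N) W) : lval (r *: z) = r *: (lval z : locR M W).
Proof.
have [m [w ->]] := fracW z.
have -> : r *: (Defs.frac m w : locR (mod_of N) W) = Defs.frac (r *: m) w.
  exact: locR_scale.
have -> : lval (Defs.frac m w) = Defs.frac (val m) w by exact: lvalE.
rewrite locR_scale -[RHS]/(Defs.frac (r *: val m) w).
by rewrite -(linearZ_LR (val : mod_of N -> M)); exact: lvalE.
Qed.

End SubLocalization.

Section TestConditions.
Variables (p : nat) (R : comPzRingType) (FpR : Fp_algebra p R).
Variables (C : cartier_algebra FpR) (M : lmodType R) (a : cartier_action C M).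
Variable N : cartier_submod a.

Definition generic_test : Prop := exists n c, nzd R c /\
  forall xs m, size xs = n -> N (c *: cact_seq a xs m).

(** [c] lies outside every associated prime x of M, so C_+^n M_x is in N_x, and Frobenius linearity
    preserves power torsion. The kernel vanishes because localization is exact. *)
Lemma generic_test_condition :
  (forall c (m : M), nzd R c -> c *: m = 0 -> m = 0) ->
  generic_test -> test_condition N.
Proof.
move=> torsion_free [n [c [nc cP]]] x [v vP].
have xc : ~ x c.
  move=> /vP/(torsion_free _ _ nc) v0; apply: (@spec_proper _ x).
  by apply/vP; rewrite v0 scaler0.
split; first by exists 0%N => xs /size0nil -> m _ /lval_eq0.
exists n => xs sxs z [k tor].
have [m [w ez]] := fracW z; have [m' e] := cact_seq_frac a (W := cpl x) xs m w.
have ePsi : cact_seq (loc_action a (cpl x)) xs z = Defs.frac (cact_seq a xs m') w.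
  by rewrite ez.
pose d := denM (mkden (xc : cpl x c)) w.
pose y : locR (mod_of N) (cpl x) := Defs.frac (to_mod (cP xs m' sxs)) d.
have ey : loc_map val y = cact_seq (loc_action a (cpl x)) xs z.
  rewrite ePsi lvalE to_modK; apply/frac_eq; exists 1; first exact: mset1.
  by rewrite scalerA dvalM !mul1r mulrC.
exists y => //; exists k => s ss xs'.
apply: lval_eq0; rewrite lvalZ ey cact_seq_frob.
have -> : (\prod_(c0 <- s) c0) ^+ (p ^ deg xs) *: z = 0.
  by rewrite -(prednK (pexp_gt0 FpR (deg xs))) exprSr -scalerA tor // scaler0.
exact: (cact_seq0 (loc_action a (cpl x)) xs).
Qed.

(* The converse needs M to be generically R^o: [th] embeds it in R, and [d]
   spans a copy of R in it. *)
Lemma test_condition_generic (th : M -> R) (d : M) :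
  noetherian R ->
  (forall x : spec R, Ass (R^o : lmodType R) x -> ~ krull_dim_ge (lring (cpl x)) 1) ->
  linear (th : M -> R^o) -> (forall m, th m = 0 -> m = 0) ->
  (forall r : R, r *: d = 0 -> r = 0) ->
  test_condition N -> generic_test.
Proof.
move=> noethR dim0 lth th0 d0 testN.
(* For each n these c form an ideal, increasing in n. It remains to find, for each associated prime
   of R, an element of the union outside it. *)
pose G n (c : (R^o : lmodType R)) : Prop :=
  forall xs m, size xs = n -> N ((c : R) *: cact_seq a xs m).
have G0 n : G n 0 by move=> xs m _; rewrite scale0r; exact: submod0.
have Gl n (r : R) c c' : G n c -> G n c' -> G n (r *: c + c').
  move=> Gc Gc' xs m sxs; rewrite scalerDl -scalerA.
  by apply: submod_lin; [exact: Gc | exact: Gc'].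
pose J n : submod (R^o : lmodType R) := Submod (G0 n) (@Gl n).
have Jmono n k : (n <= k)%N -> forall c, J n c -> J k c.
  move=> nk c Jc xs m sxs; rewrite -(cat_take_drop n xs) cact_seq_cat; apply: Jc.
  by apply: size_takel; rewrite sxs.
have dir n k : exists l, (forall r, J n r -> J l r) /\ (forall r, J k r -> J l r).
  by exists (maxn n k); split=> r; apply: Jmono; rewrite ?leq_maxl ?leq_maxr.
have [|c [n Jc] nc] := @nzd_in_ideal R (dirU 0%N dir) noethR dim0; last first.
  by exists n, c.
move=> x assx; have [r rP] := assx.
have [k nilx] := dim0_nilpotent noethR (dim0 _ assx).
have assM : Ass M x.
  exists (r *: d) => c; rewrite rP; split=> [e|].
    by rewrite scalerA; have -> : c * r = 0 by []; rewrite scale0r.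
  by rewrite scalerA => /d0.
have [_ [n nP]] := testN x assM.
(* These are the elements of M whose image in M_x lies in N_x. As [th] embeds M in R, they form a
   finitely generated module, and one [u] outside [x] moves them all into N. *)
pose H0 (m : M) : Prop := exists2 u, cpl x u & N (u *: m).
have H00 : H0 0 by exists 1; [exact: mset1 | rewrite scaler0; exact: submod0].
have H0l t m m' : H0 m -> H0 m' -> H0 (t *: m + m').
  move=> [u xu Nu] [v xv Nv]; exists (u * v); first exact: msetM.
  rewrite scalerDr; apply: submodD.
    have -> : u * v *: (t *: m) = (v * t) *: (u *: m) by rewrite !scalerA; congr (_ *: _); ring.
    exact: submodZ.
  by rewrite -scalerA; exact: submodZ.
have [|u xu uP] := @uniform_den R M (Submod H00 H0l) N (cpl x) _ (fun h Hh => Hh).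
  by apply: (@fg_separated R noethR M (fun=> th) (fun=> lth) 1) => v _ /(_ 0%N isT)/th0.
exists u => //; exists n => xs m sxs; apply: uP.
(* The ideal x is nilpotent in R_x, so every element of M_x is power torsion. *)
have [|z _] := nP xs sxs (Defs.frac m (den1 _)).
  exists k => s ss sx; rewrite locR_scale.
  have [v xv v0] := nilx s ss sx.
  rewrite -(frac0 _ (den1 _)); apply/frac_eq; exists v => //.
  by rewrite dval1 mulr1 scalerA v0 scale0r scaler0.
rewrite cact_seq_frac1; have [m' [w ->]] := fracW z.
have -> : loc_map val (Defs.frac m' w) = Defs.frac (val m') w by exact: lvalE.
move=> /frac_eq[v xv e]; exists (v * dval w); first exact: msetM (denP w).
by rewrite e; apply: submodZ; exact: mod_ofP.
Qed.
End TestConditions.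

(** * Self-injectivity of Gorenstein artinian local rings *)

Section ArtinianLocal.
Variables (A : comPzRingType) (mx : submod (A^o : lmodType A)).
Hypothesis mx_unit : forall a : A, ~ mx a -> exists b, a * b = 1.
Hypothesis mx_nil : exists k, forall s : seq A, size s = k ->
  (forall c, c \in s -> mx c) -> \prod_(c <- s) c = 0.

(* Baer's criterion for the maximal ideal; since that ideal is nilpotent, it
   implies the criterion for all ideals. *)
Definition baer (M : lmodType A) : Prop := forall phi : mod_of mx -> M,
  linear phi -> exists z, forall a, phi a = (val a : A) *: z.

Lemma injective_baer (M : lmodType A) : injective_mod M -> baer M.
Proof.
move=> injM phi lphi; pose A' : lmodType A := A^o.
have [||h [lh hP]] := @injM (mod_of mx) A' val phi _ _ lphi.
- by move=> a x y; exact: linearP.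
- exact: val_inj.
exists (h (1 : A)) => a; rewrite -hP -(linZ lh); congr h.
exact: esym (mulr1 (val a : A)).
Qed.

Section Extension.
Variables (M Y : lmodType A) (baerM : baer M) (y0 : Y) (m0 : M).
Hypothesis ann0 : forall a : A, a *: y0 = 0 -> a *: m0 = 0.

(* Partial linear maps with value m0 at y0, as graphs. *)
Let graph (G : submod (Y * M : lmodType A)%type) : Prop :=
  G (y0, m0) /\ forall z, G (0, z) -> z = 0.

Let line (u : Y * M) : Prop := exists a : A, u = (a *: y0, a *: m0).
Let line0 : line 0. Proof. by exists 0; rewrite !scale0r. Qed.
Let line_lin (a : A) u v : line u -> line v -> line (a *: u + v).
Proof.
move=> [b ->] [c ->]; exists (a * b + c); rewrite !scalerDl -!scalerA.
by [].
Qed.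
Let graph_line : graph (Submod line0 line_lin).
Proof.
split; first by exists 1; rewrite !scale1r.
by move=> z [a [/esym/ann0 az ->]].
Qed.

Let graph_uniq G : graph G -> forall y z z', G (y, z) -> G (y, z') -> z = z'.
Proof.
move=> [_ G0] y z z' Gz Gz'; apply/eqP; rewrite -subr_eq0; apply/eqP; apply: G0.
have -> : (0, z - z') = (y, z) - (y, z') :> Y * M by congr pair; rewrite subrr.
exact: submodB.
Qed.

(** By Baer's condition the partial map on mx y sends a y to a z for some [z]. Adding (y, z) keeps a
    graph: a scalar moving y into the domain lies in mx, since a unit would put y there. *)
Let dom_step G y : graph G -> ~ (exists z, G (y, z)) ->
  (forall a : A, mx a -> exists z, G (a *: y, z)) ->
  exists2 G', graph G' & (forall u, G u -> G' u) /\ exists z, G' (y, z).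
Proof.
move=> gG ny my.
pose phi (a : mod_of mx) : M := projT1 (cid (my _ (mod_ofP a))).
have phiP a : G ((val a : A) *: y, phi a) by rewrite /phi; case: cid.
have lphi : linear phi.
  move=> b a a'; apply: (graph_uniq gG (phiP _)).
  have := submod_lin b (phiP a) (phiP a').
  have -> : val (b *: a + a') = b * (val a : A) + (val a' : A) :> A by [].
  by rewrite scalerDl -scalerA.
have [z zP] := baerM lphi.
pose G1 (u : Y * M) : Prop := exists a : A, G (u - a *: (y, z)).
have G10 : G1 0 by exists 0; rewrite scale0r subrr; exact: submod0.
have G1l (b : A) u v : G1 u -> G1 v -> G1 (b *: u + v).
  move=> [a Ga] [c Gc]; exists (b * a + c).
  have -> : b *: u + v - (b * a + c) *: (y, z) =
    b *: (u - a *: (y, z)) + (v - c *: (y, z)).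
    by rewrite scalerDl -scalerA scalerBr opprD addrACA.
  exact: submod_lin.
have GG1 u : G u -> G1 u by exists 0; rewrite scale0r subr0.
exists (Submod G10 G1l); split=> //.
- by apply: GG1; have [] := gG.
- move=> v [a Ga].
  have {Ga}: G (- (a *: y), v - a *: z).
    by have <- : (0, v) - a *: (y, z) = (- (a *: y), v - a *: z) by congr pair; rewrite /= add0r.
  move=> Ga; have xa : mx a.
    apply: contrapT => /mx_unit[b ab]; apply: ny; exists (- b *: (v - a *: z)).
    have := submodZ (- b) Ga.
    have -> // : - b *: (- (a *: y), v - a *: z) = (y, - b *: (v - a *: z)).
    by congr pair; rewrite scaleNr scalerN opprK scalerA mulrC ab scale1r.
  case: gG => _; apply.
  have := submodD Ga (phiP (to_mod xa)); rewrite zP to_modK.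
  have -> // : (- (a *: y), v - a *: z) + (a *: y, a *: z) = (0, v).
  by congr pair; rewrite /= ?addNr ?subrK.
- by exists z, 1; rewrite scale1r subrr; exact: submod0.
Qed.

(** Zorn's lemma gives a maximal graph. As mx is nilpotent, an element y outside its domain has a
    multiple s y still outside with mx s y inside, and [dom_step] enlarges the graph. *)
Lemma extend_cyclic : exists psi : Y -> M, linear psi /\ psi y0 = m0.
Proof.
pose X := {G | graph G}.
pose r : rel X := fun G H => `[< forall u, proj1_sig G u -> proj1_sig H u >].
have [|G H K /asboolP h /asboolP h'|B Btot|[G gG] Gmax] :=
  @ZL_preorder X (exist _ _ graph_line) r.
- by move=> G; apply/asboolP.
- by apply/asboolP; auto.
- case: (pselect (exists G, B G)) => [[G1 B1]|B0]; last first.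
    by exists (exist _ _ graph_line) => G BG; case: B0; exists G.
  pose F (i : {G : X | B G}) := proj1_sig (proj1_sig i).
  have dir : forall x y, exists z, (forall v, F x v -> F z v) /\
    (forall v, F y v -> F z v).
    move=> [G BG] [H BH]; have [/asboolP h|/asboolP h] := Btot _ _ BG BH.
      by exists (exist _ H BH).
    by exists (exist _ G BG).
  have gU : graph (dirU (exist _ G1 B1) dir).
    split; first by exists (exist _ G1 B1); rewrite /F /=; case: (proj2_sig G1).
    by move=> z [[H BH] Hz]; case: (proj2_sig H) => _; apply.
  exists (exist _ _ gU) => G BG; apply/asboolP => u Gu.
  by exists (exist _ G BG).
have tot y : exists z, G (y, z).
  apply: contrapT => ny.
  have [s ns sm] : exists2 s : seq A, ~ (exists z, G (\prod_(c <- s) c *: y, z)) &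
    forall c, mx c -> exists z, G (c *: (\prod_(c <- s) c *: y), z).
    apply: contrapT => H.
    have [s [ss sm ns]] : exists s : seq A, [/\ size s = projT1 (cid mx_nil),
      forall c, c \in s -> mx c & ~ exists z, G (\prod_(c <- s) c *: y, z)].
      elim: (projT1 _) => [|n [s [ss sm ns]]].
        by exists [::]; rewrite big_nil scale1r.
      have [c mc nc] : exists2 c, mx c & ~ exists z, G (c *: (\prod_(c <- s) c *: y), z).
        apply: contrapT => nc; apply: H; exists s => // c mc.
        by apply: contrapT => ?; apply: nc; exists c.
      exists (c :: s); rewrite big_cons -scalerA /= ss; split=> // d.
      by rewrite inE => /predU1P[->|/sm].
    apply: ns; exists 0; move: ss; case: cid => /= k kP /kP ->//.
    by rewrite scale0r; exact: submod0.
  have [G' gG' [GG' [z Gz]]] := dom_step gG ns sm.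
  apply: ns; exists z.
  have /asboolP := Gmax (exist _ G' gG') (asboolT GG'); exact.
pose psi y := projT1 (cid (tot y)).
have psiP y : G (y, psi y) by rewrite /psi; case: cid.
exists psi; split; last by apply: (graph_uniq gG (psiP y0)); have [] := gG.
by move=> a u v; have h := submod_lin a (psiP u) (psiP v); apply: (graph_uniq gG (psiP _)); exact: h.
Qed.

End Extension.

(* For M -> I -> Q as in the definition of the injective dimension, a map from
   mx to M extends to A because every map from the residue field, embedded in A
   as the socle element sg, to Q lifts to I. *)
Lemma injdim_baer (sg : A) : (forall a : A, mx a <-> a * sg = 0) ->
  forall n M, injdim_le n M -> baer M.
Proof.
move=> sgP n M; elim=> {n M} [M|n M I Q i q injI li lq inj_i ex surj _ baerQ].
  exact: injective_baer.
move=> phi lphi.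
have [|y yP] := injective_baer injI (phi := i \o phi).
  by move=> a u v; rewrite /= lphi li.
have qi u : q (i u) = 0 by apply/ex; exists u.
(* On mx the map [i \o phi] is multiplication by [y], so mx kills [q y]. Hence sending sg to q y is
   well defined on A sg and extends to A. The correction [sg *: y'] made below vanishes on mx. *)
have [a a0|psi [lpsi psiP]] :=
  @extend_cyclic Q (A^o : lmodType A) baerQ (sg : A) (q y).
  have ma : mx a by apply/sgP.
  by have := yP (to_mod ma); rewrite to_modK /= -(linZ lq) => <-.
have [y' ey'] := surj (psi (1 : A)).
have /ex[z ez] : q (y - sg *: y') = 0.
  rewrite (linB lq) (linZ lq) ey' -(linZ lpsi) -psiP.
  have -> : sg *: (1 : A^o) = sg by exact: mulr1.
  by rewrite subrr.
exists z => a; apply: inj_i; rewrite (linZ li) -ez -[LHS]/((i \o phi) a) yP.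
rewrite scalerBr scalerA (_ : (val a : A) * sg = 0) ?scale0r ?subr0 //.
by apply/sgP; exact: mod_ofP.
Qed.

End ArtinianLocal.

Section FullSubmodule.
Variables (A : pzRingType) (V : lmodType A).
Definition full_mod : submod V := @Submod A V (fun=> True) I (fun _ _ _ _ _ => I).
End FullSubmodule.

Lemma fg_full (A : pzRingType) (V : lmodType A) : fg V -> fg_sub (full_mod V).
Proof. by move=> [n [g gP]]; exists n, g; split. Qed.

Lemma ass_nzd (R : comPzRingType) (x : spec R) c :
  Ass (R^o : lmodType R) x -> nzd R c -> ~ x c.
Proof.
move=> [r rP] nc /rP cr; have r0 : r = 0 by apply: nc.
by apply: (@spec_proper _ x); apply/rP; rewrite r0 scaler0.
Qed.

Lemma inK_inj (R : comPzRingType) : injective (inK R).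
Proof.
move=> a b /afrac_eq[u nu]; rewrite !dval1 mulr1 /= => e.
apply/eqP; rewrite -subr_eq0; apply/eqP; apply: nu.
by rewrite mulrBr e subrr.
Qed.

Lemma inL_unit (R S : comPzRingType) (f : {rmorphism R -> S}) c :
  nzd R c -> exists z, inL f (f c) * z = 1.
Proof.
move=> nc; pose w : den (nzd R) := mkden nc.
exists (afrac 1 w); rewrite afracM; apply/afrac_eq.
exists 1; first exact: mset1.
by rewrite dvalM dval1 !mul1r !mulr1 rmorph1 mul1r.
Qed.

Lemma inK_afrac (R : comPzRingType) c (r : R) w (b : R) :
  inK R c * (afrac r w : Ktot R) = inK R b <-> c * r = dval w * b.
Proof.
have E : inK R c * (afrac r w : Ktot R) = afrac (c * r) (denM (den1 _) w) :> Ktot R.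
  exact: afracM.
rewrite E; split=> [/afrac_eq[u nu]|e].
  rewrite dvalM !dval1 mulr1 mul1r /= => e.
  apply/eqP; rewrite -subr_eq0; apply/eqP; apply: nu.
  by rewrite mulrBr e mulrA subrr.
apply/afrac_eq; exists 1; first exact: mset1.
by rewrite dvalM !dval1 !mul1r /=.
Qed.

Lemma KtoLM (R S : comPzRingType) (f : {rmorphism R -> S}) a b :
  KtoL f (a * b) = KtoL f a * KtoL f b.
Proof.
have [r [w ->]] := lalgW a; have [s [v ->]] := lalgW b.
by rewrite afracM !KtoLE rmorphM afracM.
Qed.

(** * The trace and its dual module *)

Section Trace.
Variables (R S : comPzRingType) (f : {rmorphism R -> S}) (T : mod_of (omega f)).
Hypotheses (noethR : noetherian R) (f_finite : finite_morphism f).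
Hypothesis T_gen : generically_iso T.

Lemma omegaD (psi : mod_of (omega f)) s t : val psi (s + t) = val psi s + val psi t.
Proof. exact: (linD (mod_ofP psi)). Qed.
Lemma omegaZ (psi : mod_of (omega f)) r s : val psi (f r * s) = r * val psi s.
Proof. exact: (linZ (mod_ofP psi) r s). Qed.

Lemma omega_valZ (psi : mod_of (omega f)) r s : val (r *: psi) s = r * val psi s.
Proof. by []. Qed.

Lemma omega_valD (psi phi : mod_of (omega f)) s : val (psi + phi) s = val psi s + val phi s.
Proof. by []. Qed.

Lemma twist_lin : linear (twist T).
Proof.
move=> r x y; apply: val_inj; apply/funext => t.
have -> : val (r *: twist T x + twist T y) t = r * val T (x * t) + val T (y * t) by [].
rewrite -omegaZ -omegaD; congr (val T _).
have -> : r *: x + y = f r * x + y :> S by [].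
by rewrite mulrDl mulrA.
Qed.

(** Injectivity of the generic isomorphism: if z = s / w, then [twist T s] vanishes. *)
Lemma TK_nondeg z : (forall s, TK T (z * inL f s) = 0) -> z = 0.
Proof.
have [s [w ->]] := lalgW z => e.
have Ts t : val T (s * t) = 0.
  have /afrac_eq[u nu] : afrac (val T (s * t)) (denM w (den1 _)) =
      afrac 0 (den1 _) :> Ktot R.
    transitivity (0 : Ktot R); last by symmetry; exact: frac0.
    by have := e t; rewrite afracM TKE.
  rewrite mulr0 => /= eu; apply: (_ : nzd R (u * dval (den1 (nzd R)))) => //.
  exact: msetM (denP _).
apply: (bij_inj T_gen); rewrite (loc_mapE _ _ twist_lin).
rewrite -[in RHS](frac0 _ (den1 _)) (loc_mapE _ _ twist_lin) (lin0 twist_lin).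
have -> : twist T s = 0 by apply: val_inj; apply/funext => t; exact: Ts.
by rewrite !frac0.
Qed.

(** Surjectivity of the generic isomorphism, with denominators cleared. *)
Lemma omega_twist (psi : mod_of (omega f)) :
  exists2 c, nzd R c & exists s, forall t, c * val psi t = val T (s * t).
Proof.
have [h _ hK] := T_gen; pose z := Defs.frac psi (den1 (nzd R)).
have [s [w es]] := lalgW (h z); have := hK z; rewrite es.
have -> : loc_map (twist T) (afrac s w) = Defs.frac (twist T s) w.
  exact: (loc_mapE _ _ twist_lin).
move=> /esym/frac_eq[u nu]; rewrite dval1 mulr1 => e.
exists (u * dval w); first exact: msetM (denP w).
exists (f u * s) => t; rewrite -[f u * s * t]mulrA omegaZ.
by rewrite -[LHS]omega_valZ e omega_valZ.
Qed.

Lemma TKfM c z : TK T (inL f (f c) * z) = inK R c * TK T z.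
Proof. by rewrite inL_f TKM. Qed.

Opaque Ktot Ltot inK inL KtoL TK.

(* The S-submodule of L corresponding to omega under x |-> T_K(x -). *)
Let dual_set (z : Lmod f) : Prop :=
  forall s, exists b, TK T ((z : Ltot f) * inL f s) = inK R b.
Let dual0 : dual_set 0.
Proof.
move=> s; exists 0; rewrite mul0r rmorph0.
by apply: (@addIr _ (TK T 0)); rewrite -TKD !add0r.
Qed.
Let dual_lin (a : S) z t : dual_set z -> dual_set t -> dual_set (a *: z + t).
Proof.
move=> dz dt s; have [b eb] := dz (a * s); have [c ec] := dt s.
exists (b + c); rewrite rmorphD -eb -ec -TKD rmorphM; congr (TK T _).
by rewrite rscal_regE mulrDl; congr (_ + _); ring.
Qed.
Definition dual_mod : submod (Lmod f) := Submod dual0 dual_lin.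

(** A homomorphism is determined by its values on finitely many generators of S, so omega embeds in
    a power of R. *)
Lemma omega_fg : fg_sub (full_mod (mod_of (omega f))).
Proof.
have [n [g gP]] := f_finite.
pose g' (i : nat) : S := if insub i is Some j then g j else 0.
apply: (@fg_separated R noethR (mod_of (omega f)) (fun i psi => val psi (g' i)) _ n).
  by move=> i a u v; rewrite omega_valD omega_valZ.
move=> v _ h; apply: val_inj; apply/funext => s /=.
have [c ->] := gP s; rewrite [LHS](lin_sum (mod_ofP v)) big1 // => i _.
rewrite (linZ (mod_ofP v)); have := h i (ltn_ord i); rewrite /g' valK => ->.
exact: scaler0.
Qed.

(** As omega is finitely generated, one [c] makes every c psi a twist of T. For the psi given by z,
    nondegeneracy turns c psi = T(s -) into c z = s. *)
Lemma dual_mod_bounded : exists2 c, nzd R c & forall z, dual_mod z ->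
  exists s, inL f (f c) * z = inL f s.
Proof.
pose tw (psi : mod_of (omega f)) : Prop := exists s, forall t, val psi t = val T (s * t).
have T0 : val T 0 = 0 by exact: (lin0 (mod_ofP T)).
have tw0 : tw 0 by exists 0 => t; rewrite mul0r T0.
have twl (a : R) u v : tw u -> tw v -> tw (a *: u + v).
  move=> [s es] [s' es']; exists (f a * s + s') => t.
  rewrite mulrDl omegaD -mulrA omegaZ -es -es'.
  by rewrite omega_valD omega_valZ.
have [|c nc cP] := @uniform_den R _ _ (Submod tw0 twl) (nzd R) omega_fg.
  move=> psi _; have [c nc [s sP]] := omega_twist psi.
  by exists c => //; exists s => t; rewrite omega_valZ sP.
exists c => // z dz.
pose psi s := projT1 (cid (dz s)).
have psiP s : TK T (z * inL f s) = inK R (psi s) by rewrite /psi; case: cid.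
have lpsi : omega f psi.
  move=> r s t; suff : psi (f r * (s : S) + (t : S)) = r * psi s + psi t by [].
  apply: inK_inj; rewrite rmorphD rmorphM -!psiP -TKfM -TKD; congr (TK T _).
  by rewrite rmorphD rmorphM; ring.
have [s sP] := cP (to_mod lpsi) I.
exists s; apply/eqP; rewrite -subr_eq0; apply/eqP; apply: TK_nondeg => t.
rewrite mulrBl; apply: (@addIr _ (TK T (inL f s * inL f t))).
rewrite -TKD subrK add0r -rmorphM TK_inL -sP -mulrA TKfM psiP -rmorphM.
by [].
Qed.

Lemma dual_full s : dual_mod (inL f s).
Proof. by move=> t; exists (val T (s * t)); rewrite -rmorphM TK_inL. Qed.

(* An associated prime of L / dual_mod lies over a prime q of R associated to
   K / R, hence of height at most 1 by S_2, so that q is in U. *)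
Lemma pull_div_dual (noethS : noetherian S) (S2R : serre_S 2 (R^o : lmodType R))
    (I : submod (Kmod R)) (U : spec R -> Prop) d :
  (forall x : spec R, ~ krull_dim_ge (lring (cpl x)) 2 -> U x) ->
  (forall a, I a -> exists b, inK R d * a = inK R b) ->
  forall z, pull_div f I U z -> dual_mod (inL f (f d) * z).
Proof.
move=> codim1 dI z zU.
have dext (t : Ltot f) : ext_set I t -> exists s, inL f (f d) * t = inL f s.
  move=> It; elim: It => [|s a t' /dI[b eb] _ [s' e]]; first by exists 0; rewrite mulr0 rmorph0.
  have fb : inL f (f b) = inL f (f d) * KtoL f a by rewrite inL_f -eb KtoLM -inL_f.
  by exists (s * f b + s'); rewrite rmorphD rmorphM fb -e mulrDr mulrCA.
set y := inL f (f d) * z.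
apply: contrapT => /(ass_exists noethS)[b [Q QP]].
pose v := inL f b * y.
have {}QP s : Q s <-> dual_mod (inL f s * v) by exact: QP.
pose Nv (t : rscal f S^o) : Prop := exists c, TK T (v * inL f t) = inK R c.
have Nv0 : Nv 0.
  exists 0; rewrite !rmorph0 mulr0.
  by apply: (@addIr _ (TK T 0)); rewrite -TKD !add0r.
have Nvl (r : R) t t' : Nv t -> Nv t' -> Nv (r *: t + t').
  move=> [c ec] [c' ec']; exists (r * c + c').
  have -> : r *: t + t' = f r * (t : S) + (t' : S) :> S by [].
  rewrite !rmorphD !rmorphM -ec -ec' -TKfM -TKD; congr (TK T _).
  by rewrite mulrDr mulrCA.
pose q := spec_map f Q.
have qP r : q r <-> forall t, Nv (f r * t).
  split=> [/QP h t|h]; last apply/QP => t.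
    by have [c ec] := h t; exists c; rewrite -ec rmorphM; congr (TK T _); ring.
  by have [c ec] := h t; exists c; rewrite -ec rmorphM; congr (TK T _); ring.
(* If no single [t] worked, a common denominator would give r outside q with r t in [Nv] for all t,
   which says that r is in q. So q is the annihilator of T_K(v t) in K / R. *)
have [t tP] : exists t, forall r, Nv (f r * t) -> q r.
  apply: contrapT => nt.
  have [|r qr rP] := @uniform_den R _ _ (Submod Nv0 Nvl) (cpl q) (fg_full f_finite).
    move=> t _; apply: contrapT => h; apply: nt; exists t => r Nr.
    by apply: contrapT => qr; apply: h; exists r.
  by apply: qr; apply/qP => t; exact: rP.
have [r [w ew]] := lalgW (TK T (v * inL f t)).
have qd1 : ~ krull_dim_ge (lring (cpl q)) 2.
  apply: (@ass_quotient_dim1 R q (dval w) r S2R (denP w)) => c.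
  have E : Nv (f c * t) <-> exists b0, (c : R) * r = dval w * b0.
    have -> : Nv (f c * t) = exists b0, inK R (c : R) * afrac r w = inK R b0.
      by rewrite -ew -TKfM /Nv rmorphM mulrCA.
    split=> -[b0 e]; exists b0.
      exact: (proj1 (@inK_afrac R c r w b0) e).
    exact: (proj2 (@inK_afrac R c r w b0) e).
  by split=> [/qP h|h]; [apply/E; exact: h | apply: tP; exact/E].
(* Now q is in U, so s z is in I S for some s outside Q. Multiplying by d lands in S, which lies in
   [dual_mod], and this forces s into Q. *)
have [s Qs /dext[s' es']] := zU Q (codim1 _ qd1).
apply: Qs; apply/QP.
have -> : inL f s * v = inL f b * (inL f (f d) * (inL f s * z)) by rewrite /v /y; ring.
by rewrite es' -rmorphM; exact: dual_full.
Qed.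

(** [d] moves the sections of f^*D into the dual module and a second multiplier moves that into S.
    So S(f^*D) contains a unit of L. *)
Lemma SD_contains (noethS : noetherian S) (S2R : serre_S 2 (R^o : lmodType R))
    (I : submod (Kmod R)) (U : spec R -> Prop) d : nzd R d ->
  (forall x : spec R, ~ krull_dim_ge (lring (cpl x)) 2 -> U x) ->
  (forall a, I a -> exists b, inK R d * a = inK R b) ->
  exists2 c, nzd R c & SD f I U (inL f (f c)).
Proof.
move=> nd codim1 dI; have [c nc cP] := dual_mod_bounded.
exists (c * d); first exact: msetM.
move=> z /(pull_div_dual noethS S2R codim1 dI)/cP[s e].
by exists s; rewrite -e !rmorphM mulrA.
Qed.

(* The extension to S of the map from R / ker f to R with value r at 1 exists at
   the associated primes of R because their local rings are self-injective. *)
Lemma trace_image (r : R) : (forall x : spec R, Ass (R^o : lmodType R) x ->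
    ~ krull_dim_ge (lring (cpl x)) 1) -> G1 R ->
  (forall j, f j = 0 -> j * r = 0) ->
  exists2 c, nzd R c & exists s, c * r = val T s.
Proof.
move=> dim0 G1R Jr.
pose im (c : (R^o : lmodType R)) : Prop := exists s, (c : R) * r = val T s.
have im0 : im 0 by exists 0; rewrite mul0r (lin0 (mod_ofP T)).
have iml (a : R) b c : im b -> im c -> im (a *: b + c).
  move=> [s es] [t et]; exists (f a * s + t).
  rewrite omegaD omegaZ -es -et.
  by transitivity ((a * (b : R) + c) * r) => //; ring.
(* It is enough to find, at each associated prime x of R, a multiplier outside x. *)
have [|c [s e] nc] := nzd_in_ideal (I := Submod im0 iml) noethR dim0; last first.
  by exists c => //; exists s.
move=> x assx; have [r0 r0P'] := assx.
have r0P (c : R) : x c <-> c * (r0 : R) = 0 by exact: r0P'.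
pose A := lring (cpl x); pose m := loc_prime (fun a (xa : x a) => xa).
have m_unit (a : A) : ~ m a -> exists b, a * b = 1.
  have [b [w ->]] := lalgW a => mb; apply: contrapT => nb; apply: mb.
  by apply/loc_primeE; exact: lring_nonunit nb.
have m_nil : exists k, forall s : seq A, size s = k ->
  (forall c, c \in s -> m c) -> \prod_(c <- s) c = 0.
  have [k kP] := dim0_nilpotent noethR (dim0 _ assx); exists k => s ss sm.
  have [s' [w [ss' sx ->]]] : exists s' w, [/\ size s' = k,
    (forall c, c \in s' -> x c) & \prod_(c <- s) c = afrac (\prod_(c <- s') c) w :> A].
    rewrite -ss; elim: s {ss} sm => [|c s IH] sm.
      by exists [::], (den1 _); rewrite !big_nil.
    have [|s' [w [ss' sx es]]] := IH; first by move=> d ds; apply: sm; rewrite inE ds orbT.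
    have [b [v ec]] := lalgW c.
    exists (b :: s'), (denM v w); rewrite !big_cons /= ss' es ec afracM; split=> // d.
    rewrite inE => /predU1P[->|/sx //].
    by apply/(loc_primeE (fun a (xa : x a) => xa) b v); rewrite -ec; apply: sm; rewrite inE eqxx.
  have [u xu e] := kP s' ss' sx.
  transitivity (afrac 0 w : A); last exact: frac0.
  apply/afrac_eq; exists u; first exact: xu.
  by rewrite mulr0 /= mulrAC e mul0r.
(* As [r0] has annihilator x, [sg] spans a copy of the residue field. *)
pose sg : A := afrac r0 (den1 _).
have sgP (a : A) : m a <-> a * sg = 0.
  have [b [w ->]] := lalgW a; rewrite loc_primeE afracM r0P.
  rewrite (_ : 0 = afrac 0 (den1 _) :> A); last exact: esym (frac0 _ _).
  split=> [e|/afrac_eq[u xu]].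
    apply/afrac_eq; exists 1; first exact: mset1.
    by rewrite e !mulr0.
  rewrite mulr0 dval1 mulr1 /= => e.
  by have /r0P/spec_prime[/xu//|/r0P //] : u * b * r0 = 0 by rewrite -mulrA.
have baerA : baer m (A^o : lmodType A).
  have [|n injA] := G1R x; last exact: (injdim_baer m_unit m_nil sgP injA).
  move=> [ch chP]; apply: (dim0 _ assx); exists ch => i i0; apply: chP.
  exact: ltnW.
pose Y : lmodType A := loc (cpl x) (rscal f S^o).
pose fr (s : S) : Y := Defs.frac (s : rscal f S^o) (den1 (cpl x)).
have frZ (t : R) w s : (afrac t w : A) *: fr s = Defs.frac (f t * s : rscal f S^o) (denM w (den1 _)).
  exact: fracZ.
pose inA (t : R) : A := lring_in (cpl x) t.
have inAE t : inA t = afrac t (den1 _) by [].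
have inA0 t : inA t = 0 <-> exists2 u, ~ x u & u * t = 0.
  rewrite inAE (_ : 0 = afrac 0 (den1 _) :> A); last exact: esym (frac0 _ _).
  by rewrite lring_eq dval1; split=> -[u xu e]; exists u => //; move: e; rewrite mulr1 mulr0.
have inAD t t' : inA (t + t') = inA t + inA t' by exact: rmorphD.
have inAB t t' : inA (t - t') = inA t - inA t' by exact: rmorphB.
have inAM t t' : inA (t * t') = inA t * inA t' by exact: rmorphM.
have inA_0 : inA 0 = 0 by exact: rmorph0.
(* If t / w kills 1 in S_x, then u t is in ker f for some u outside x, and so kills r. Hence 1 -> r
   is well defined and extends to S_x -> R_x. *)
have [a|psi [lpsi psi1]] := extend_cyclic m_unit m_nil baerA
    (y0 := fr 1) (m0 := (inA r : A^o)).
  have [t [w ->]] := lalgW a; rewrite frZ mulr1.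
  rewrite -(frac0 _ (den1 _)) => /frac_eq[u xu].
  rewrite scaler0 dval1 mulr1 rscal_regE -rmorphM => /Jr e.
  have -> : (afrac t w : A) *: (inA r : A^o) = (afrac t w : A) * inA r by [].
  rewrite inAE afracM (_ : 0 = afrac 0 (den1 _) :> A); last exact: esym (frac0 _ _).
  by apply/lring_eq; exists u => //; rewrite dval1 mulr1 mulr0 mulrA.
have frL t s s' : fr (f t * s + s') = inA t *: fr s + fr s'.
  have -> : inA t *: fr s = fr (f t * s).
    rewrite inAE frZ; apply/frac_eq; exists 1; first exact: mset1.
    by rewrite dvalM dval1 !mulr1.
  exact: esym (fracDr _ _ _).
have fr0 : fr 0 = 0 by exact: frac0.
have psiL t s s' : psi (fr (f t * s + s')) = inA t * psi (fr s) + psi (fr s').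
  by rewrite frL [LHS]lpsi.
have psiZ t s : psi (fr (f t * s)) = inA t * psi (fr s).
  by have := psiL t s 0; rewrite fr0 (lin0 lpsi) !addr0.
pose D (s : rscal f S^o) : Prop := exists b, psi (fr s) = inA b.
have D0 : D 0 by exists 0; rewrite fr0 (lin0 lpsi) inA_0.
have Dl (t : R) s s' : D s -> D s' -> D (t *: s + s').
  move=> [b eb] [b' eb']; exists (t * b + b').
  by rewrite inAD inAM -eb -eb' -psiL.
have [|w xw wP] := @uniform_den R _ _ (Submod D0 Dl) (cpl x) (fg_full f_finite).
  move=> s _; have [b [w ew]] := lalgW (psi (fr s)); exists (dval w); first exact: cpl_den.
  exists b; rewrite [LHS](psiZ (dval w) s) ew !inAE afracM; apply/lring_eq.
  by exists 1; [exact: spec_proper | rewrite dvalM !dval1; ring].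
(* The kernel of R -> R_x. The values [beta] chosen below are determined, and linear, only modulo Z;
   the factor [w'], which kills Z, repairs this. *)
pose Z (b : (R^o : lmodType R)) : Prop := inA b = 0.
have Z0 : Z 0 by exact: inA_0.
have Zl (t : R) b b' : Z b -> Z b' -> Z (t *: b + b').
  move=> eb eb'; have : inA (t * b + b') = 0 by rewrite inAD inAM eb eb' mulr0 addr0.
  by [].
have [|w' xw' w'P] := @uniform_den R _ (Submod Z0 Zl) (zero_mod (R^o : lmodType R))
  (cpl x) (fg_ideal noethR _).
  by move=> b /inA0[u xu ub]; exists u.
have {}w'P b b' : inA b = inA b' -> w' * b = w' * b'.
  move=> e; apply/eqP; rewrite -subr_eq0 -mulrBr; apply/eqP; apply: w'P.
  by rewrite /= /Z inAB e subrr.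
pose beta s := projT1 (cid (wP s I)).
have betaP s : inA w * psi (fr s) = inA (beta s).
  by rewrite -psiZ /beta; case: cid.
have lbeta : omega f (fun s => w' * beta s).
  move=> t s s'; transitivity (w' * (t * beta s + beta s')); last first.
    by rewrite mulrDr mulrCA.
  apply: w'P; rewrite -betaP [psi _]psiL mulrDr mulrCA !betaP.
  by rewrite inAD inAM.
have [c nc [s sP]] := omega_twist (to_mod lbeta).
(* [w] clears the denominators of psi, [w'] removes the ambiguity modulo Z, and [c] makes the
   resulting map a twist of T. *)
exists (c * w' * w).
  exists s; have /= := sP 1; rewrite mulr1 => <-.
  rewrite -!mulrA; congr (c * _); apply: w'P.
  by rewrite -betaP psi1 inAM.
by move=> /spec_prime[/spec_prime[/(ass_nzd assx nc)|]|].
Qed.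

End Trace.
Transparent Ktot Ltot inK inL KtoL TK.

(** * The kernel of f and fractional ideals *)

(** If j in ker f were not nilpotent, some prime would avoid j, and dominance would give a prime of
    S avoiding f j = 0. As Frobenius is additive, the j in ker f killed by p^e-th powers form ideals
    increasing with e, so one e serves all. *)
Lemma ker_nilpotent (p : nat) (R S : comPzRingType) (f : {rmorphism R -> S}) :
  Fp_algebra p R -> noetherian R -> dominant f ->
  exists e, forall j, f j = 0 -> j ^+ (p ^ e) = 0.
Proof.
move=> FpR noethR dom.
have p_gt1 : (1 < p)%N by apply: prime_gt1; case: FpR.
have nil j : f j = 0 -> exists n, j ^+ n = 0.
  move=> fj.
  pose N (r : (R^o : lmodType R)) : Prop := exists n, j ^+ n * (r : R) = 0.
  have N0 : N 0 by exists 0%N; rewrite mulr0.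
  have Nl (a : R) r s : N r -> N s -> N (a *: r + s).
    move=> [n en] [m em]; exists (n + m)%N.
    transitivity (a * j ^+ m * (j ^+ n * (r : R)) + j ^+ n * (j ^+ m * (s : R))).
      by rewrite exprD -[a *: r + s]/(a * (r : R) + (s : R) : R); ring.
    by rewrite en em !mulr0 addr0.
  apply: contrapT => nj.
  have n1 : ~ (Submod N0 Nl) (1 : R).
    by move=> [n]; rewrite mulr1 => e; apply: nj; exists n.
  have [b [x xP]] := ass_exists noethR n1.
  have {}xP c : x c <-> N (c * (b * 1) : R) by exact: xP.
  have [|Q] := dom j; last by apply; rewrite /= fj; exact: submod0.
  exists x => /xP[n e]; apply: (@spec_proper _ x); apply/xP.
  by exists n.+1; rewrite mul1r exprSr -mulrA.
pose F e (j : (R^o : lmodType R)) : Prop := f j = 0 /\ (j : R) ^+ (p ^ e) = 0.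
have F0 e : F e 0.
  by split; rewrite ?rmorph0 // expr0n expn_eq0; case: p p_gt1 {FpR F}.
have Fl e (a : R) j k : F e j -> F e k -> F e (a *: j + k).
  move=> [fj ej] [fk ek].
  have -> : a *: j + k = a * (j : R) + (k : R) :> R by [].
  by split; rewrite ?rmorphD ?rmorphM ?fj ?fk ?mulr0 ?addr0 // Fp_exprD // exprMn ej ek mulr0 addr0.
have Fmono e d j : (e <= d)%N -> F e j -> F d j.
  move=> /subnKC <- [fj ej]; split=> //.
  by rewrite expnD exprM ej expr0n expn_eq0; case: (p) p_gt1.
have dir x y : exists z, (forall v, Submod (F0 x) (@Fl x) v -> Submod (F0 z) (@Fl z) v) /\
    (forall v, Submod (F0 y) (@Fl y) v -> Submod (F0 z) (@Fl z) v).
  by exists (maxn x y); split=> v; apply: Fmono; rewrite ?leq_maxl ?leq_maxr.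
have [e eP] := fg_dirU (fg_ideal noethR (dirU 0%N dir)).
exists e => j fj; have [n jn] := nil j fj.
have [//|_ //] := eP j _.
exists n; split=> //.
by rewrite -(subnKC (ltnW (ltn_expl n p_gt1))) exprD jn mul0r.
Qed.

Section FractionalIdeals.
Variables (R : comPzRingType) (I : submod (Kmod R)).

Lemma gen_divisor_den : fg (mod_of I) ->
  exists2 d, nzd R d & forall a, I a -> exists b, inK R d * a = inK R b.
Proof.
move=> /fg_subP fgI.
pose N (a : Kmod R) : Prop := exists b, (a : Ktot R) = inK R b.
have N0 : N 0 by exists 0; rewrite rmorph0.
have Nl (r : R) a b : N a -> N b -> N (r *: a + b).
  move=> [c ec] [d ed]; exists (r * c + d).
  by rewrite rmorphD rmorphM -ec -ed.
have [|d nd dP] := @uniform_den R _ I (Submod N0 Nl) (nzd R) fgI; last by exists d.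
move=> a _; have [r [w ->]] := lalgW (a : Ktot R); exists (dval w); first exact: denP.
by exists r; apply/inK_afrac.
Qed.

(** Let i / w correspond to 1 in K and let i = r / v. Then r = v i is in I, and b r = 0 makes b v
    kill 1 in K, so b = 0. *)
Lemma gen_divisor_nzd : iso_mod (loc (nzd R) (mod_of I)) (Ktot R)^o ->
  exists2 r, nzd R r & I (inK R r).
Proof.
move=> [g [lg [h gK hK]]]; have [i [w ei]] := fracW (h (1 : Ktot R)).
have [r [v ev]] := lalgW (val i : Ktot R).
have Iv := submodZ (dval v) (mod_ofP i).
have evi : inK R (dval v) * (val i : Ktot R) = inK R r.
  by rewrite ev; apply/inK_afrac.
exists r; last by rewrite -evi.
move=> b br; apply: inK_inj; rewrite rmorph0.
have bi : (b * dval v) *: i = 0.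
  apply: val_inj; rewrite rsub_valZ rmorphM -mulrA evi -rmorphM.
  by have -> : b * r = 0 by rewrite mulrC; exact: br.
have : (inK R (b * dval v) : lring (nzd R)) *: h (1 : Ktot R) = 0.
  rewrite ei; have -> : (inK R (b * dval v) : lring (nzd R)) *: Defs.frac i w =
    Defs.frac ((b * dval v) *: i) (denM (den1 _) w) by exact: fracZ.
  by rewrite bi frac0.
move=> /(congr1 g); rewrite (linZ lg) hK (lin0 lg) => h0.
have {h0} : inK R (b * dval v) = 0 by rewrite -[LHS]mulr1.
rewrite rmorphM => h0.
have [z ez] := inL_unit (idfun : {rmorphism R -> R}) (denP v).
have {ez} ez : inK R (dval v) * z = 1 by exact: ez.
by rewrite -[LHS]mulr1 -ez mulrA h0 mul0r.
Qed.

End FractionalIdeals.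

(** The embedding is multiplication by [i a], a unit of B. *)
Lemma colon_embed (A B : comPzRingType) (i : {rmorphism A -> B})
    (J : submod (rscal i B^o)) (a : A) : injective i -> J (i a) ->
  (exists z, i a * z = 1) ->
  exists th : mod_of (colon J) -> A, linear (th : _ -> A^o) /\
    forall m, th m = 0 -> m = 0.
Proof.
move=> inji Ja [z az].
pose th (m : mod_of (colon J)) : A := projT1 (cid (mod_ofP m _ Ja)).
have thP m : (val m : B) * i a = i (th m) by rewrite /th; case: cid.
exists th; split=> [r m m'|m m0].
  apply: inji; rewrite -thP.
  have -> : r *: (th m : A^o) + th m' = r * th m + th m' by [].
  by rewrite rsub_valD rsub_valZ rmorphD rmorphM -!thP mulrDl mulrA.
apply: val_inj; have := thP m; rewrite m0 rmorph0 => /(congr1 ( *%R^~ z)).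
by rewrite mul0r -mulrA az mulr1.
Qed.

Lemma full_stable (p : nat) (R : comPzRingType) (FpR : Fp_algebra p R)
    (C : cartier_algebra FpR) (M : lmodType R) (a : cartier_action C M)
    e (k : C e) (m : M) : full_mod M m -> full_mod M (cact a k m).
Proof. by []. Qed.

Definition full_cartier (p : nat) (R : comPzRingType) (FpR : Fp_algebra p R)
    (C : cartier_algebra FpR) (M : lmodType R) (a : cartier_action C M) :
  cartier_submod a := CartierSubmod (@full_stable _ _ _ _ _ a).

(** * Trace of Cartier modules *)

Section Pullback.
Variables (p : nat) (R S : comPzRingType) (f : {rmorphism R -> S}).
Variables (FpR : Fp_algebra p R) (FpS : Fp_algebra p S).
Variables (T : mod_of (omega f)) (T_gen : generically_iso T).
Variables (C : cartier_algebra FpR) (I : submod (Kmod R)) (U : spec R -> Prop).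
Variables (a : cartier_action C (mod_of (RD I))) (a_tr : transposable T U a).
Notation pb := (pullback_action FpS T_gen a_tr).
Notation homs := (seq {e : nat & C e.+1}).
Notation pbhoms := (seq {e : nat & pullback_algebra f FpS C e.+1}).

(** The trace pairing T_K(x s) of S(f^*D) with S, with values in R(D). *)
Definition tr (x : mod_of (SD f I U)) (s : S) : mod_of (RD I) := val (varsigma T x) s.

Lemma val_tr x s : val (tr x s) = TK T (val x * inL f s).
Proof. exact: varsigmaE. Qed.

Opaque Ktot Ltot inK inL KtoL TK.

Lemma trD x y s : tr (x + y) s = tr x s + tr y s.
Proof.
apply: val_inj; rewrite rsub_valD !val_tr -TKD; congr (TK T _).
by rewrite rsub_valD mulrDl.
Qed.

Lemma trZ b x s : tr (b *: x) s = tr x (b * s).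
Proof.
apply: val_inj; rewrite !val_tr; congr (TK T _).
by rewrite rsub_valZ rmorphM; ring.
Qed.

Lemma tr_lin x (r : R) s : tr (f r *: x) s = r *: tr x s.
Proof.
apply: val_inj; rewrite rsub_valZ !val_tr -TKfM; congr (TK T _).
by rewrite rsub_valZ mulrA.
Qed.

Lemma tr_transpose e (k : C e) x s : tr (transpose a_tr k x) s = cact a k (tr x (s ^+ (p ^ e))).
Proof. exact: (transposeP a_tr k).2. Qed.

Lemma pb_cact_ptens e (k : C e) s x : cact pb (ptens f k s) x = transpose a_tr k (s *: x).
Proof. exact: (pb_cactE FpS T_gen a_tr). Qed.

Lemma pb_cact_ind e (u : pullback_algebra f FpS C e) x (P : mod_of (SD f I U) -> Prop) :
  P 0 -> (forall y z, P y -> P z -> P (y + z)) ->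
  (forall (k : C e) s, P (transpose a_tr k (s *: x))) -> P (cact pb u x).
Proof.
move=> P0 PD Pk; move: u; apply: tensor_ind => [|k s t Pt].
  have -> : cact pb (0 : pullback_algebra f FpS C e) x = 0; last exact: P0.
  by apply: (@addIr _ (cact pb (0 : pullback_algebra f FpS C e) x)); rewrite -cactDl !add0r.
rewrite -[X in X + t]/(ptens f k s).
have -> : cact pb (ptens f k s + t : pullback_algebra f FpS C e) x =
  cact pb (ptens f k s) x + cact pb t x by exact: cactDl.
by apply: PD => //; rewrite pb_cact_ptens.
Qed.

(** The trace turns a product of n elements of f^*C_+ into a sum of products of n elements of C_+.
    The induction peels off the outermost factor and replaces P by its composite with that factor,
    which is why P is arbitrary. *)
Lemma tr_cact_seq (P : mod_of (RD I) -> Prop) n :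
  P 0 -> (forall y z, P y -> P z -> P (y + z)) ->
  (forall xs m, size xs = n -> P (cact_seq a xs m)) ->
  forall ys x t, size ys = n -> P (tr (cact_seq pb ys x) t).
Proof.
elim: n P => [|n IH] P P0 PD Pseq.
  by move=> ys x t /size0nil ->; exact: (Pseq [::]).
move=> [//|[e u] ys] x t [sys] /=.
apply: (@pb_cact_ind e.+1 u _ (fun y => P (tr y t))) => [||k s].
- have -> // : tr 0 t = 0.
  by apply: (@addIr _ (tr 0 t)); rewrite -trD !add0r.
- by move=> y z Py Pz; rewrite trD; exact: PD.
rewrite tr_transpose trZ.
apply: (IH (fun m => P (cact a k m))) => //.
- by rewrite cact0.
- by move=> y z Py Pz; rewrite cactDr; exact: PD.
move=> xs m sxs; apply: (Pseq (existT _ e k :: xs)).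
by rewrite /= sxs.
Qed.

Definition pblift (xs : homs) : pbhoms :=
  [seq existT (fun e => pullback_algebra f FpS C e.+1) (projT1 x) (ptens f (projT2 x) 1) | x <- xs].

Lemma tr_pblift xs x : tr (cact_seq pb (pblift xs) x) 1 = cact_seq a xs (tr x 1).
Proof.
elim: xs => //= k xs IH.
apply: etrans (congr1 (tr^~ 1) (pb_cact_ptens _ _ _)) _.
by rewrite tr_transpose trZ mul1r expr1n IH.
Qed.

Section TraceOfSubmodule.
Variable N : cartier_submod pb.
Let im (m : mod_of (RD I)) : Prop := exists2 x, N x & m = tr x 1.
Let im0 : im 0.
Proof.
exists 0; first exact: submod0.
by apply: (@addIr _ (tr 0 1)); rewrite -trD !add0r.
Qed.
Let im_lin r m m' : im m -> im m' -> im (r *: m + m').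
Proof.
move=> [x Nx ->] [y Ny ->]; exists (f r *: x + y); first exact: submod_lin.
by rewrite trD tr_lin.
Qed.
Let im_stable e (k : C e) m : Submod im0 im_lin m -> Submod im0 im_lin (cact a k m).
Proof.
move=> [x Nx ->]; exists (cact pb (ptens f k 1) x); first exact: csub_stable.
by rewrite pb_cact_ptens tr_transpose trZ mul1r expr1n.
Qed.
Definition tr_image : cartier_submod a := CartierSubmod im_stable.
End TraceOfSubmodule.

Section Preimage.
Variable N : cartier_submod a.
(** The largest S-submodule of S(f^*D) whose trace lies in N. *)
Let pre (x : mod_of (SD f I U)) : Prop := forall s, N (tr x s).
Let pre0 : pre 0.
Proof.
move=> s; have -> : tr 0 s = 0 by apply: (@addIr _ (tr 0 s)); rewrite -trD !add0r.
exact: submod0.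
Qed.
Let pre_lin b x y : pre x -> pre y -> pre (b *: x + y).
Proof. by move=> px py s; rewrite trD trZ; exact: submodD. Qed.
Let pre_stable e (u : pullback_algebra f FpS C e) x :
  Submod pre0 pre_lin x -> Submod pre0 pre_lin (cact pb u x).
Proof.
move=> px; apply: (@pb_cact_ind e u x (Submod pre0 pre_lin)) => [||k s]; [exact: submod0 | exact: submodD |].
by move=> t; rewrite tr_transpose trZ; apply: csub_stable; exact: px.
Qed.
Definition tr_preimage : cartier_submod pb := CartierSubmod pre_stable.

Lemma tr_preimage_generic : (forall c, nzd R c -> nzd S (f c)) ->
  generic_test N -> generic_test tr_preimage.
Proof.
move=> fnzd [n [c [nc cP]]]; exists n, (f c); split; first exact: fnzd.
move=> ys x sys t; rewrite tr_lin.
apply: (tr_cact_seq (P := fun m => N (c *: m)) (n := n)) => //.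
- by rewrite scaler0; exact: submod0.
- by move=> y z Ny Nz; rewrite scalerDr; exact: submodD.
Qed.
End Preimage.

(* Elements killed by ker f are generically traces; the factors of degree at
   least e produce such elements. *)
Lemma tr_image_generic (N : cartier_submod pb) (th : mod_of (RD I) -> R) e d :
  noetherian R -> linear (th : _ -> R^o) -> (forall m, th m = 0 -> m = 0) ->
  (forall j, f j = 0 -> j ^+ (p ^ e) = 0) ->
  SD f I U (inL f (f d)) -> nzd R d ->
  (forall r, (forall j, f j = 0 -> j * r = 0) ->
    exists2 c, nzd R c & exists s, c * r = val T s) ->
  (forall c, nzd S c -> exists2 c', nzd R c' & exists b, f c' = b * c) ->
  generic_test N -> generic_test (tr_image N).
Proof.
move=> noethR lth th0 nilp SDd nd timg denS [n0 [c0 [nc0 c0P]]].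
have [c1 nc1 [b eb]] := denS _ nc0.
have {c0 nc0 c0P b eb} c1P ys x : size ys = n0 -> N (f c1 *: cact_seq pb ys x).
  by move=> sys; rewrite eb -scalerA; apply: submodZ; exact: c0P.
pose H (m : mod_of (RD I)) : Prop := forall j, f j = 0 -> j *: m = 0.
have H0 : H 0 by move=> j _; rewrite scaler0.
have Hl r m m' : H m -> H m' -> H (r *: m + m').
  by move=> Hm Hm' j fj; rewrite scalerDr scalerA mulrC -scalerA Hm // Hm' // scaler0 addr0.
have [||c2 nc2 c2P] := @uniform_den R _ (Submod H0 Hl) (tr_image (full_cartier pb)) (nzd R).
- by apply: (@fg_separated R noethR _ (fun=> th) (fun=> lth) 1) => v _ /(_ 0%N isT)/th0.
- move=> m Hm; have [r [w ew]] := lalgW (val m : Ktot R).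
  have wm : inK R (dval w) * (val m : Ktot R) = inK R r by rewrite ew; apply/inK_afrac.
  have [|c nc [s es]] := timg r.
    move=> j fj; apply: inK_inj; rewrite rmorph0 rmorphM -wm mulrCA.
    by rewrite -[X in _ * X]rsub_valZ Hm // mulr0.
  (* With w m = r and c r = T(s), the element d c w m is the trace of s f(d), where f(d) is in
     S(f^*D). *)
  exists (d * c * dval w); first by apply: msetM (denP w); exact: msetM.
  exists (s *: to_mod SDd) => //; apply: val_inj.
  transitivity (inK R (d * c * r)).
    rewrite rsub_valZ [X in X * _](rmorphM (inK R) (d * c) (dval w)) -[LHS]mulrA.
    by rewrite [X in _ * X]wm -rmorphM.
  rewrite val_tr rsub_valZ to_modK rmorph1 mulr1 -rmorphM TK_inL.
  by rewrite [s * _]mulrC omegaZ -es mulrA.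
(* The inner e factors have total degree at least e, so they carry m into the part killed by ker f.
   The outer n0 factors, lifted to f^*C and multiplied by c1, move S(f^*D) into N. *)
exists (n0 + e)%N, (c1 * c2); split; first exact: msetM.
move=> zs m szs; rewrite -(cat_take_drop n0 zs) cact_seq_cat.
set xs := take n0 zs; set xs' := drop n0 zs.
have sxs : size xs = n0 by rewrite size_takel // szs leq_addr.
have sxs' : size xs' = e by rewrite size_drop szs addKn.
have [|x _ ex] := c2P (cact_seq a xs' m).
  move=> j fj; rewrite cact_seq_frob.
  have le : (e <= deg xs')%N by rewrite -[X in (X <= _)%N]sxs' size_deg.
  have -> : j ^+ (p ^ deg xs') = 0.
    by rewrite -(subnKC le) expnD exprM nilp // expr0n (gtn_eqF (pexp_gt0 FpR _)).
  by rewrite scale0r cact_seq0.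
(* [c2] passes through the outer factors as its q-th power, q = p^(deg xs). One of the q factors
   makes the inner element the trace of x; the other q - 1 remain in front of x. *)
exists (f c1 *: cact_seq pb (pblift xs) (f (c2 ^+ (p ^ deg xs).-1) *: x)).
  by apply: c1P; rewrite size_map.
rewrite tr_lin tr_pblift tr_lin -ex -scalerA; congr (_ *: _).
by rewrite cact_seq_frob scalerA -exprSr prednK // (pexp_gt0 FpR).
Qed.

End Pullback.
Transparent Ktot Ltot inK inL KtoL TK.

(** * Comparison of the test modules *)

Lemma nzd_image (R S : comPzRingType) (f : {rmorphism R -> S}) c :
  injective (inL f) -> nzd R c -> nzd S (f c).
Proof.
move=> inj nc; apply/nzdP => b e; apply: inj; rewrite rmorph0.
have [z ez] := inL_unit f nc.
by rewrite -[LHS]mul1r -ez mulrAC -rmorphM e rmorph0 mul0r.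
Qed.

(** The inverse of c in L is a fraction s / w with w from R, so s c equals f(w) up to a
    non-zero-divisor of R. *)
Lemma nzd_multiple (R S : comPzRingType) (f : {rmorphism R -> S}) c :
  is_total_fraction_ring (inL f) -> nzd S c ->
  exists2 c', nzd R c' & exists b, f c' = b * c.
Proof.
move=> [_ [unitL _]] /unitL[y]; have [s [w ->]] := lalgW y.
rewrite /inL /lalg_in /= afracM => /afrac_eq[u nu].
rewrite dval1 dvalM dval1 mulr1 mul1r mulr1 => e.
by exists (u * dval w); [exact: msetM (denP w) | exists (f u * s); rewrite -e; ring].
Qed.

Lemma linear_torsion_free (R : comPzRingType) (M : lmodType R) (th : M -> R) c (m : M) :
  linear (th : M -> R^o) -> (forall m, th m = 0 -> m = 0) ->
  nzd R c -> c *: m = 0 -> m = 0.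
Proof.
move=> lth th0 nc e; apply: th0; apply: (nc : nzd R c).
by rewrite -[LHS](linZ lth) e (lin0 lth).
Qed.

(* I is the fractional ideal I_D of the divisor D, and f^* D is computed on an
   arbitrary open set U on which I_D is invertible and which contains all points
   of codimension at most 1. *)
Theorem theoremB (p : nat) (R S : comPzRingType)
  (FpR : Fp_algebra p R) (FpS : Fp_algebra p S)
  (noethR : noetherian R) (noethS : noetherian S)
  (FfinR : F_finite p R) (FfinS : F_finite p S)
  (G1R : G1 R) (S2R : serre_S 2 (R^o : lmodType R))
  (G1S : G1 S) (S2S : serre_S 2 (S^o : lmodType S))
  (f : {rmorphism R -> S})
  (f_finite : finite_morphism f) (f_dominant : dominant f)
  (R_hyp : is_local R \/ finite_type_over_field R)
  (L_total : is_total_fraction_ring (inL f))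
  (T : mod_of (omega f)) (T_gen : generically_iso T)
  (C : cartier_algebra FpR)
  (I : submod (Kmod R)) (I_div : gen_divisor I)
  (U : spec R -> Prop) (I_cartier : almost_cartier_on I U)
  (RD_fg : fg (mod_of (RD I)))
  (a : cartier_action C (mod_of (RD I)))
  (a_tr : transposable T U a)
  (tauS : cartier_submod (pullback_action FpS T_gen a_tr))
  (tauR : cartier_submod a)
  (tauS_test : is_test_module tauS) (tauR_test : is_test_module tauR) :
  [set TK T (val m) | m in (tauS : set (mod_of (SD f I U)))] =
  [set val m | m in (tauR : set (mod_of (RD I)))] :> set (Ktot R).
Proof.
have dimR x := @ass_dim0 R x S2R; have dimS x := @ass_dim0 S x S2S.
have fnzd c := @nzd_image R S f c L_total.1.
(* [d] lies in R(D) and f(c) in S(f^*D), where both span free modules. Multiplication by [r] embeds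
   R(D) in R and S(f^*D) in S. *)
have [d nd dI] := gen_divisor_den (gen_divisor_fg I_div).
have [r nr Ir] := gen_divisor_nzd (gen_divisor_K I_div).
have [c nc SDc] := SD_contains noethR f_finite T_gen noethS S2R nd I_cartier.2.1 dI.
have unitK b : nzd R b -> exists z, inK R b * z = 1.
  by move=> nb; exact: (inL_unit (idfun : {rmorphism R -> R}) nb).
have [thR [lthR thR0]] := colon_embed (@inK_inj R) Ir (unitK r nr).
have Pr : pull_div f I U (inL f (f r)).
  rewrite inL_f; hnf => Q _; exists 1; first exact: spec_proper.
  by rewrite rmorph1 mul1r; exact: ext_in.
have [thS [lthS thS0]] := colon_embed L_total.1 Pr (inL_unit f nr).
have RDd : RD I (inK R d) by [].
have [e nilp] := ker_nilpotent FpR noethR f_dominant.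
have genR : generic_test tauR.
  apply: (test_condition_generic (d := to_mod RDd) noethR dimR lthR thR0 _ tauR_test.1).
  move=> b /(congr1 val); rewrite rsub_valZ to_modK -rmorphM => h.
  apply: nd; rewrite mulrC; apply: inK_inj; rewrite rmorph0; exact: h.
have genS : generic_test tauS.
  apply: (test_condition_generic (d := to_mod SDc) noethS dimS lthS thS0 _ tauS_test.1).
  move=> b /(congr1 val); rewrite rsub_valZ to_modK -rmorphM => h.
  apply: (fnzd _ nc); rewrite mulrC; apply: L_total.1; rewrite rmorph0; exact: h.
have prenil := generic_test_condition
  (fun b m => @linear_torsion_free S _ thS b m lthS thS0)
  (tr_preimage_generic FpS T_gen a_tr fnzd genR).
have imnil := generic_test_condition
  (fun b m => @linear_torsion_free R _ thR b m lthR thR0)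
  (tr_image_generic noethR lthR thR0 nilp SDc nc
    (fun r0 => @trace_image _ _ _ _ noethR f_finite T_gen r0 dimR G1R)
    (fun b => @nzd_multiple R S f b L_total) genS).
(* Minimality of [tauS] is applied to the preimage of [tauR], and minimality of [tauR] to the image
   of [tauS]. *)
apply/seteqP; split=> [_ [x tx <-]|_ [m tm <-]].
  exists (tr T x 1); first exact: (tauS_test.2 _ prenil x tx 1).
  by rewrite val_tr rmorph1 mulr1.
have [x tx ->] := tauR_test.2 _ imnil m tm.
by exists x => //; rewrite val_tr rmorph1 mulr1.
Qed.
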